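(* Let $d\in\mathbb{N}$, $\Omega=\{1,2,\ldots,d\}^{\mathbb{N}}$, and let $A:\Omega\to\mathbb{R}$ be a Hölder potential which is not cohomologous to a constant. For $t\in\mathbb{R}$ let $\mu_{tA}$ be the unique linear equilibrium probability for $tA$ and let $\hat c(t)=P(tA)-\log d$. Then the equation in $t$ $$\hat c'(t)=\mu_{tA}(A)=\int A(x)\,\mu_{tA}(\mathrm{d}x)=t$$ determines the possible values of $t$ for which the linear equilibrium probability for $tA$ maximizes the quadratic pressure; that is, if $t\in\mathbb{R}$ is such that $\rho=\mu_{tA}$ attains the supremum $$\mathfrak{P}_{2}(A)=\sup_{\rho\in\mathcal{P}(T)}\left\{\frac{\rho(A)^2}{2}+h(\rho)-\log d\right\},$$ then $\hat c'(t)=\mu_{tA}(A)=t$.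
   Context: $T:\Omega\to\Omega$ is the shift $T(x_1,x_2,\ldots)=(x_2,x_3,\ldots)$; $\Omega$ carries the metric $d(x,y)=2^{-\min\{n:\,x_n\neq y_n\}}$, and ''Hölder'' refers to this metric. $\mathcal{P}(T)$ is the set of $T$-invariant Borel probabilities on $\Omega$, $h(\rho)$ is the Kolmogorov-Sinai entropy of $\rho\in\mathcal{P}(T)$, and $\rho(A)=\int A\,\mathrm{d}\rho$. The linear pressure is $P(A)=\sup_{\rho\in\mathcal{P}(T)}\{\rho(A)+h(\rho)\}$; a maximizer is called a linear equilibrium probability for $A$; for Hölder $A$ it is unique and denoted $\mu_A$. $A$ is cohomologous to a constant if $A=\alpha+B\circ T-B$ for some $\alpha\in\mathbb{R}$ and some Hölder function $B:\Omega\to\mathbb{R}$. *)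

(* Defs.v *)
From HB Require Import structures.
From mathcomp Require Import all_boot all_order all_algebra.
From mathcomp Require Import all_classical all_reals all_analysis.

Set Implicit Arguments.
Unset Strict Implicit.
Unset Printing Implicit Defensive.

Import Order.TTheory GRing.Theory Num.Theory.
Import numFieldNormedType.Exports.

Local Open Scope classical_set_scope.
Local Open Scope ring_scope.

(* The alphabet {1, ..., d} is 'I_k.+1 with d = k.+1 (measurable types
   of the library are pointed, so the alphabet has to be syntactically
   nonempty).  Coordinates are numbered from 0: x n stands for x_{n+1}.
   R is a parameter of the type because it is the range of the metric. *)
Definition Omega (R : realType) (k : nat) : Type := nat -> 'I_k.+1.

Section Omega_metric.
Context {R : realType} {k : nat}.
Implicit Types x y z : Omega R k.

(* 2 ^ - min {n >= 1 : x_n <> y_n} for coordinates numbered from 1,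
   whence the exponent (ex_minn h).+1; the distance is 0 when x = y. *)
Definition Omega_dist x y : R :=
  match pselect (exists n, x n != y n) with
  | left h => 2^-1 ^+ (ex_minn h).+1
  | right _ => 0
  end.

Lemma Omega_distxx x : Omega_dist x x = 0.
Proof.
rewrite /Omega_dist; case: pselect => // h.
by have [n] := h; rewrite eqxx.
Qed.

Lemma Omega_dist_positivity x y : Omega_dist x y = 0 -> x = y.
Proof.
rewrite /Omega_dist; case: pselect => [h /eqP|h _].
  by rewrite expf_eq0 /= invr_eq0 pnatr_eq0.
by apply/funext => n; apply/eqP/negPn/negP => xy; apply: h; exists n.
Qed.

Lemma Omega_dist_le x y n : (forall m, (m < n)%N -> x m = y m) ->
  Omega_dist x y <= 2^-1 ^+ n.+1.
Proof.
move=> xy; rewrite /Omega_dist; case: pselect => [h|_]; last first.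
  by rewrite exprn_ge0 // invr_ge0 ler0n.
case: ex_minnP => m xym _.
rewrite ler_wiXn2l ?invr_ge0 ?ler0n ?invf_le1 ?ltr0n ?ler1n // ltnS leqNgt.
by apply/negP => mn; rewrite (xy m mn) eqxx in xym.
Qed.

Lemma Omega_dist_ge x y n : x n != y n -> 2^-1 ^+ n.+1 <= Omega_dist x y.
Proof.
move=> xy; rewrite /Omega_dist; case: pselect => [h|]; last by case; exists n.
case: ex_minnP => m _ /(_ n xy) mn.
by rewrite ler_wiXn2l ?invr_ge0 ?ler0n ?invf_le1 ?ltr0n ?ler1n.
Qed.

Lemma Omega_dist_ge0 x y : 0 <= Omega_dist x y.
Proof.
by rewrite /Omega_dist; case: pselect => // h; rewrite exprn_ge0 // invr_ge0.
Qed.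

Lemma Omega_dist_sym x y : Omega_dist x y = Omega_dist y x.
Proof.
have le_sym u v : Omega_dist u v <= Omega_dist v u.
  rewrite {1}/Omega_dist; case: pselect => [h|_]; last exact: Omega_dist_ge0.
  by case: ex_minnP => m uv _; apply: Omega_dist_ge; rewrite eq_sym.
by apply/eqP; rewrite eq_le !le_sym.
Qed.

Lemma Omega_dist_triangle y x z :
  Omega_dist x z <= Omega_dist x y + Omega_dist y z.
Proof.
rewrite {1}/Omega_dist; case: pselect => [h|_]; last first.
  by rewrite addr_ge0 ?Omega_dist_ge0.
case: ex_minnP => m xz _; have [xy|xy] := eqVneq (x m) (y m).
  by rewrite ler_wpDl ?Omega_dist_ge0 // Omega_dist_ge // -xy.
by rewrite ler_wpDr ?Omega_dist_ge0 // Omega_dist_ge.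
Qed.

End Omega_metric.

Section Omega_structures.
Variables (R : realType) (k : nat).

HB.instance Definition _ := gen_eqMixin (Omega R k).
HB.instance Definition _ := gen_choiceMixin (Omega R k).
HB.instance Definition _ := isPointed.Build (Omega R k) (fun=> ord0).
HB.instance Definition _ := @isMetric.Build R (Omega R k) Omega_dist
  Omega_distxx Omega_dist_positivity Omega_dist_sym Omega_dist_triangle.

(* Borel sigma-algebra of the metric topology *)
HB.instance Definition _ := Measurable.copy (Omega R k)
  (g_sigma_algebraType (@open (Omega R k))).

End Omega_structures.

Section Kolmogorov_Sinai_entropy.
Context d (X : measurableType d) (R : realType).
Implicit Types (T : X -> X) (mu : probability X R).

Definition invariant_measure T mu :=
  forall B : set X, measurable B -> mu (T @^-1` B) = mu B.

Definition measurable_partition m (P : 'I_m -> set X) :=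
  [/\ forall i, measurable (P i),
      trivIset [set: 'I_m] P &
      \bigcup_(i in [set: 'I_m]) P i = [set: X]].

(* The cell indexed by w of the join of P, T^-1 P, ..., T^-(n-1) P. *)
Definition join_cell T m (P : 'I_m -> set X) n (w : {ffun 'I_n -> 'I_m}) :
    set X :=
  \bigcap_(i in [set: 'I_n]) (iter i T @^-1` P (w i)).

Definition join_entropy T mu m (P : 'I_m -> set X) n : R :=
  - \sum_(w : {ffun 'I_n -> 'I_m})
      fine (mu (join_cell T P w)) * ln (fine (mu (join_cell T P w))).

(* For an invariant mu the limit exists, by subadditivity. *)
Definition partition_entropy T mu m (P : 'I_m -> set X) : R :=
  limn (fun n => join_entropy T mu P n / n%:R).

Definition entropy T mu : \bar R :=
  ereal_sup [set e : \bar R | exists m (P : 'I_m -> set X),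
    measurable_partition P /\ e = (partition_entropy T mu P)%:E].

End Kolmogorov_Sinai_entropy.

Section pressure.
Context {R : realType} {k : nat}.
Implicit Types (A : Omega R k -> R) (rho : probability (Omega R k) R).

Definition left_shift (x : Omega R k) : Omega R k := fun n => x n.+1.

Definition hoelder_continuous A := exists (C theta : R), 0 < theta <= 1 /\
  forall x y, `|A x - A y| <= C * mdist x y `^ theta.

Definition cohomologous_to_constant A :=
  exists (alpha : R) (B : Omega R k -> R),
    hoelder_continuous B /\ forall x, A x = alpha + B (left_shift x) - B x.

Definition mean rho A : R := \int[rho]_x A x.

Definition pressure A : \bar R :=
  ereal_sup [set ((mean rho A)%:E + entropy left_shift rho)%E |
             rho in invariant_measure (R := R) left_shift].

Definition linear_equilibrium A rho :=
  invariant_measure left_shift rho /\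
  ((mean rho A)%:E + entropy left_shift rho)%E = pressure A.

Definition quadratic_value A rho : \bar R :=
  ((mean rho A ^+ 2 / 2)%:E + entropy left_shift rho - (ln k.+1%:R)%:E)%E.

Definition quadratic_pressure A : \bar R :=
  ereal_sup [set quadratic_value A rho |
             rho in invariant_measure (R := R) left_shift].

(* The pressure of a Hoelder potential is finite, so fine loses nothing. *)
Definition chat A (t : R) : R :=
  fine (pressure (fun x => t * A x)) - ln k.+1%:R.

End pressure.

(* Main.v *)
From HB Require Import structures.
Require Import Defs.
From mathcomp Require Import all_boot all_order all_algebra.
From mathcomp Require Import all_classical all_reals all_analysis.
From mathcomp Require Import ring lra zify.
Set Implicit Arguments.
Unset Strict Implicit.
Unset Printing Implicit Defensive.
Import Order.TTheory GRing.Theory Num.Theory.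
Import numFieldNormedType.Exports.
Local Open Scope classical_set_scope.
Local Open Scope ring_scope.

(** Write m = mu(A) and h for the entropy of mu = mu_tA. Since
    s rho(A) <= (s^2 + rho(A)^2)/2, quadratic maximality of mu gives
    m s + h <= P(sA) <= m s + h + (s - m)^2/2 for every s. Hence the pressure is
    differentiable at m with derivative m, and mu is a linear equilibrium for mA
    as well as for tA. It remains to see that t = m.

    Suppose t <> m. Then s |-> P(sA) is affine between t and m. Let Z_n(s) be the
    sum of exp(s S_n A) over the cylinders of length n. Block-Bernoulli measures
    give Z_n(s) <= C exp(n P(sA)) for s = t, m, and the cylinder entropies of mu
    give Z_n(s) >= exp(n P(sA))/C at the midpoint, so the variance of S_n A under
    the midpoint Gibbs weights is bounded in n. If two words u, u' of the same
    length had very different Birkhoff sums, swapping u and u' at the sites of a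
    long concatenation would make this variance grow linearly. So the
    oscillation of S_n A is bounded in n, all points of period n have the same
    Birkhoff sum, and Livsic's argument makes A cohomologous to a constant. *)

(** * Shannon entropy of finite distributions *)

(** The swaps gain only a factor 1 + c r for r blocks, so even a polynomial loss in n would spoil
    the contradiction. Every comparison with Z_n must hold for each n with a constant independent of
    n. Hence the entropy of mu is bounded by H_n / n for every single n, not only in the limit, and
    Birkhoff sums enter through the distortion constant E = C / (1 - z). The exponents then cancel
    exactly: s m + h is affine in s, so twice its value at the midpoint is the sum of its values at
    t and m. In the variance bound the obstacle is that Gibbs weights on concatenations are not
    product weights. Each site i gets a test function g i of mean zero. The g i have geometrically
    decaying correlations because the mixed second differences of the Birkhoff sum decay. With G the
    sum of the g i, Var f >= Cov(f, G)^2 / Var G is of order r^2 / r. *)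

Section shannon_entropy.
Context {R : realType}.
Implicit Types (F G H : finType).

Definition shannon F (p : F -> R) : R := - \sum_a p a * ln (p a).

Definition push F G (g : F -> G) (p : F -> R) (b : G) : R :=
  \sum_(a | g a == b) p a.

(** This is ln x <= x - 1 at x = q / p, multiplied by p. Since [ln 0 = 0] here, q has to be positive
    wherever p is. *)
Lemma mulr_lnB_le (p q : R) : 0 <= p -> (0 < p -> 0 < q) -> 0 <= q ->
  p * ln q - p * ln p <= q - p.
Proof.
rewrite le_eqVlt => /predU1P[<- _ q0|p0 /(_ p0) q0 _].
  by rewrite !mul0r !subr0.
rewrite -mulrBr -ln_div ?posrE// -ler_pdivlMl//.
have -> : p^-1 * (q - p) = q / p - 1.
  by rewrite mulrBr mulVf ?gt_eqF// mulrC.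
have qp : 0 < q / p by rewrite divr_gt0.
have := @le_ln1Dx R (q / p - 1); rewrite [1 + _]addrC subrK; apply.
by rewrite ltrBrDl subrr.
Qed.

(** The mass of [q] may be smaller than that of [p]: in [shannon_joint] the weights [q] are a
    product measure restricted to the image of an injection. *)
Lemma gibbs F (p q : F -> R) : (forall a, 0 <= p a) -> (forall a, 0 <= q a) ->
  (forall a, 0 < p a -> 0 < q a) -> \sum_a q a <= \sum_a p a ->
  shannon p <= - \sum_a p a * ln (q a).
Proof.
move=> p0 q0 pq qp; rewrite /shannon lerN2 -subr_ge0 -sumrB.
rewrite -oppr_le0 -sumrN (@le_trans _ _ (\sum_a (q a - p a)))//.
  by apply: ler_sum => a _; rewrite opprB mulr_lnB_le//; apply: pq.
by rewrite sumrB subr_le0.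
Qed.

Lemma push_ge0 F G (g : F -> G) (p : F -> R) b :
  (forall a, 0 <= p a) -> 0 <= push g p b.
Proof. by move=> p0; apply: sumr_ge0. Qed.

Lemma sum_push F G (g : F -> G) (p : F -> R) (v : G -> R) :
  \sum_b push g p b * v b = \sum_a p a * v (g a).
Proof.
rewrite [RHS](partition_big g predT)//=.
apply: eq_bigr => b _; rewrite mulr_suml; apply: eq_bigr => a.
by move=> /eqP ->.
Qed.

Lemma sum_push1 F G (g : F -> G) (p : F -> R) :
  \sum_b push g p b = \sum_a p a.
Proof.
transitivity (\sum_b push g p b * 1); first by under [RHS]eq_bigr do rewrite mulr1.
by rewrite sum_push; under eq_bigr do rewrite mulr1.
Qed.

Lemma eq_push F G (g g' : F -> G) (p p' : F -> R) :
  g =1 g' -> p =1 p' -> push g p =1 push g' p'.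
Proof.
move=> gg' pp' b; rewrite /push; apply: eq_big => a; first by rewrite gg'.
by rewrite pp'.
Qed.

Lemma eq_shannon F (p p' : F -> R) : p =1 p' -> shannon p = shannon p'.
Proof. by move=> pp'; congr (- _); apply: eq_bigr => a _; rewrite pp'. Qed.

Lemma le_push F G (g : F -> G) (p : F -> R) a :
  (forall a, 0 <= p a) -> p a <= push g p (g a).
Proof.
by move=> p0; rewrite /push (bigD1 a)//= lerDl sumr_ge0.
Qed.

(** Merging atoms can only enlarge the weight inside the logarithm. *)
Lemma shannon_push F G (g : F -> G) (p : F -> R) : (forall a, 0 <= p a) ->
  shannon (push g p) <= shannon p.
Proof.
move=> p0; rewrite /shannon lerN2 (sum_push g p (fun b => ln (push g p b))).
apply: ler_sum => a _; have := p0 a; rewrite le_eqVlt => /predU1P[<-|pa].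
  by rewrite !mul0r.
have pg := le_push g a p0.
by rewrite ler_pM2l// ler_ln ?posrE// (lt_le_trans pa).
Qed.

Lemma shannon_ge0 F (p : F -> R) : (forall a, 0 <= p a) -> \sum_a p a = 1 ->
  0 <= shannon p.
Proof.
move=> p0 p1; rewrite oppr_ge0; apply: sumr_le0 => a _.
rewrite mulr_ge0_le0// ln_le0// -p1 (bigD1 a)//= lerDl sumr_ge0//.
Qed.

(** Gibbs' inequality against the product of the two marginals. By injectivity H embeds into F x G,
    so these product weights have total mass at most 1 on H. *)
Lemma shannon_joint F G H (f : H -> F) (g : H -> G) (p : H -> R) :
  injective (fun c => (f c, g c)) ->
  (forall a, 0 <= p a) -> \sum_a p a = 1 ->
  shannon p <= shannon (push f p) + shannon (push g p).
Proof.
move=> fgI p0 p1.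
have pf a : 0 < p a -> 0 < push f p (f a).
  by move=> pa; apply: lt_le_trans (le_push f a p0).
have pg a : 0 < p a -> 0 < push g p (g a).
  by move=> pa; apply: lt_le_trans (le_push g a p0).
have := @gibbs H p (fun a => push f p (f a) * push g p (g a)) p0.
move=> /(_ _ _ _)/le_trans; apply.
- by move=> a; rewrite mulr_ge0// push_ge0.
- by move=> a pa; rewrite mulr_gt0// ?pf ?pg.
- rewrite p1.
  have -> : 1 = (\sum_a push f p a) * (\sum_b push g p b).
    by rewrite !sum_push1 p1 mulr1.
  rewrite big_distrlr pair_bigA /=.
  rewrite [leRHS](bigID (mem (codom (fun c => (f c, g c)))))/= -big_uniq /=; last first.
    by rewrite /codom map_inj_uniq ?enum_uniq.
  rewrite big_map big_enum /= lerDl sumr_ge0// => -[a b] _.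
  by rewrite mulr_ge0// push_ge0.
- rewrite /shannon (sum_push f p (fun b => ln (push f p b))).
  rewrite (sum_push g p (fun b => ln (push g p b))) -opprD lerN2 -big_split/=.
  apply: ler_sum => a _; have := p0 a; rewrite le_eqVlt => /predU1P[<-|pa].
    by rewrite !mul0r addr0.
  by rewrite lnM ?posrE ?pf ?pg// mulrDr.
Qed.

(** Concavity of entropy: Gibbs' inequality for each [p i] against the average, then the mean over
    i. *)
Lemma shannon_avg F n (p : 'I_n.+1 -> F -> R) :
  (forall i a, 0 <= p i a) -> (forall i, \sum_a p i a = 1) ->
  n.+1%:R^-1 * (\sum_i shannon (p i)) <=
  shannon (fun a => n.+1%:R^-1 * \sum_i p i a).
Proof.
move=> p0 p1; pose q a := n.+1%:R^-1 * \sum_i p i a; rewrite -/q.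
have q0 a : 0 <= q a by rewrite mulr_ge0 ?invr_ge0 ?sumr_ge0.
have pq i : shannon (p i) <= - \sum_a p i a * ln (q a).
  apply: gibbs => // [a pa|].
    rewrite mulr_gt0 ?invr_gt0 ?ltr0n// (bigD1 i)//= ltr_pwDl// sumr_ge0//.
  rewrite -mulr_sumr exchange_big /=; under eq_bigr do rewrite p1.
  by rewrite sumr_const card_ord mulVf ?pnatr_eq0 ?p1.
rewrite {2}/shannon -[in leRHS]sumrN.
have -> : \sum_a - (q a * ln (q a)) = n.+1%:R^-1 * \sum_i - \sum_a p i a * ln (q a).
  under eq_bigr do rewrite -mulrN /q -mulrA.
  rewrite -mulr_sumr; congr (_ * _); under eq_bigr do rewrite mulr_suml.
  rewrite exchange_big /=; apply: eq_bigr => i _; rewrite -sumrN.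
  by apply: eq_bigr => a _; rewrite mulrN.
by rewrite ler_wpM2l ?invr_ge0// ler_sum.
Qed.

(** [v (b j)] is a product over the sites with trivial factors away from j, so the sum over b
    factors, and each site other than j contributes 1. *)
Lemma prod_marginal F r (p : F -> R) (v : F -> R) (j : 'I_r) :
  \sum_a p a = 1 ->
  \sum_(b : {ffun 'I_r -> F}) (\prod_i p (b i)) * v (b j) = \sum_a p a * v a.
Proof.
move=> p1.
have -> : \sum_a p a * v a = \prod_(i < r) \sum_a p a * (if i == j then v a else 1).
  rewrite (bigD1 j)//= eqxx [X in _ * X]big1 ?mulr1// => i /negPf ->.
  by under eq_bigr do rewrite mulr1.
rewrite bigA_distr_bigA /=; apply: eq_bigr => b _.
rewrite big_split/=; congr (_ * _).
rewrite (bigD1 j)//= eqxx [X in _ * X]big1 ?mulr1// => i /negPf -> //.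
Qed.

Lemma shannon_prod F r (p : F -> R) : (forall a, 0 < p a) -> \sum_a p a = 1 ->
  shannon (fun b : {ffun 'I_r -> F} => \prod_i p (b i)) = r%:R * shannon p.
Proof.
move=> p0 p1; rewrite /shannon mulrN; congr (- _).
have lnprod (b : {ffun 'I_r -> F}) :
    ln (\prod_i p (b i)) = \sum_i ln (p (b i)).
  suff : 0 < \prod_i p (b i) /\ ln (\prod_i p (b i)) = \sum_i ln (p (b i)) by case.
  apply: (big_rec2 (fun x y => 0 < x /\ ln x = y)); rewrite ?ln1//.
  by move=> i x y _ [y0 <-]; rewrite mulr_gt0// lnM ?posrE.
under eq_bigr do rewrite lnprod mulr_sumr.
rewrite exchange_big /=.
under eq_bigr => i _ do rewrite (prod_marginal (fun a => ln (p a)) i p1).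
by rewrite sumr_const card_ord mulr_natl.
Qed.

(** The finite variational principle: Gibbs' inequality against the weights exp S / Z. [gibbs_distP]
    gives the equality case. *)
Lemma shannon_free_energy F (p S : F -> R) :
  (forall a, 0 <= p a) -> \sum_a p a = 1 ->
  shannon p + \sum_a p a * S a <= ln (\sum_a expR (S a)).
Proof.
move=> p0 p1.
have [a0 _|F0] := pickP F; last first.
  by move: p1; rewrite big_pred0// => /esym/eqP; rewrite oner_eq0.
have Z0 : 0 < \sum_a expR (S a).
  by rewrite (bigD1 a0)//= ltr_pwDl ?expR_gt0// sumr_ge0// => *; exact: expR_ge0.
rewrite -lerBrDr.
apply: (le_trans (@gibbs F p (fun a => expR (S a) / \sum_a expR (S a)) p0 _ _ _)).
- by move=> a; rewrite divr_ge0 ?expR_ge0 ?ltW.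
- by move=> a _; rewrite divr_gt0 ?expR_gt0.
- by rewrite -mulr_suml mulfV ?gt_eqF// p1.
- under eq_bigr do rewrite ln_div ?posrE ?expR_gt0// expRK mulrBr.
  by rewrite sumrB -mulr_suml p1 mul1r opprB.
Qed.

Definition gibbs_dist F (S : F -> R) (a : F) : R :=
  expR (S a) / \sum_a expR (S a).

Lemma gibbs_distP F (S : F -> R) (a0 : F) :
  [/\ 0 < \sum_a expR (S a), forall a, 0 < gibbs_dist S a,
    \sum_a gibbs_dist S a = 1 &
    shannon (gibbs_dist S) + \sum_a gibbs_dist S a * S a =
    ln (\sum_a expR (S a))].
Proof.
have Z0 : 0 < \sum_a expR (S a).
  by rewrite (bigD1 a0)//= ltr_pwDl ?expR_gt0// sumr_ge0// => *; exact: expR_ge0.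
have p1 : \sum_a gibbs_dist S a = 1 by rewrite -mulr_suml mulfV ?gt_eqF.
split => // [a|]; first by rewrite divr_gt0 ?expR_gt0.
rewrite /shannon -sumrN -big_split/=.
under eq_bigr => a _.
  rewrite -mulrN -mulrDr {2}/gibbs_dist ln_div ?posrE ?expR_gt0// expRK.
  by rewrite opprB subrK; over.
by rewrite -mulr_suml p1 mul1r.
Qed.

End shannon_entropy.

(** * A linear lower bound for variances of Gibbs weights *)

Section geometric_sums.
Context {R : realType}.
Implicit Types z : R.

Lemma geo_sum_le z n : 0 <= z < 1 -> \sum_(j < n) z ^+ j <= (1 - z)^-1.
Proof.
move=> /andP[z0 z1]; rewrite -[leRHS]mul1r ler_pdivlMr ?subr_gt0//.
have -> : (\sum_(j < n) z ^+ j) * (1 - z) = 1 - z ^+ n.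
  by rewrite mulrC -opprB mulNr -subrX1 opprB.
by rewrite gerBl exprn_ge0.
Qed.

Lemma geo_sum_rev_le z n N : 0 <= z < 1 -> (n <= N)%N ->
  \sum_(j < n) z ^+ (N - j) <= z ^+ (N - n) / (1 - z).
Proof.
move=> z01 nN; rewrite (reindex_inj rev_ord_inj)/=.
have /andP[z0 z1] := z01.
apply: (@le_trans _ _ (z ^+ (N - n) * \sum_(j < n) z ^+ j)); last first.
  by rewrite ler_wpM2l ?exprn_ge0// geo_sum_le.
rewrite mulr_sumr; apply: ler_sum => j _; rewrite -exprD.
by rewrite ler_wiXn2l ?(ltW z1)//; have := ltn_ord j; lia.
Qed.

(** With truncated subtraction, [(i - j) + (j - i)] is |i - j|. The sum is cut after j = i into two
    one-sided geometric sums. *)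
Lemma geo_sum_dist_le z r (i : nat) : 0 <= z < 1 -> (i < r)%N ->
  \sum_(j < r) z ^+ ((i - j) + (j - i)) <= 2 / (1 - z).
Proof.
move=> z01 ir; have /andP[z0 z1] := z01.
rewrite -(big_mkord predT (fun j => z ^+ ((i - j) + (j - i)))).
rewrite (big_cat_nat (n := i.+1))//=.
have -> : 2 / (1 - z) = (1 - z)^-1 + (1 - z)^-1 :> R by rewrite mulr_natl mulr2n.
apply: lerD.
  rewrite big_mkord.
  rewrite (@le_trans _ _ (\sum_(j < i.+1) z ^+ (i.+1 - j - 1)))//.
    by apply: ler_sum => j _; rewrite ler_wiXn2l ?(ltW z1)//; have := ltn_ord j; lia.
  rewrite (reindex_inj rev_ord_inj)/= (le_trans _ (geo_sum_le i.+1 z01))//.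
  by apply: ler_sum => j _; rewrite ler_wiXn2l ?(ltW z1)//; have := ltn_ord j; lia.
rewrite -{1}[i.+1]add0n big_addn big_mkord (le_trans _ (geo_sum_le (r - i.+1) z01))//.
by apply: ler_sum => j _; rewrite ler_wiXn2l ?(ltW z1)//; have := ltn_ord j; lia.
Qed.

Lemma expR_lipschitz (x y M : R) : x <= M -> y <= M ->
  `|expR x - expR y| <= expR M * `|x - y|.
Proof.
wlog yx : x y / y <= x => [hw xM yM|xM yM].
  have [yx|/ltW xy] := leP y x; first exact: hw.
  by rewrite distrC [in leRHS]distrC; exact: hw.
rewrite !ger0_norm ?subr_ge0 ?ler_expR//.
apply: (@le_trans _ _ (expR x * (x - y))); last first.
  by rewrite ler_wpM2r ?subr_ge0// ler_expR.
have -> : expR x - expR y = expR x * (1 - expR (y - x)).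
  by rewrite mulrBr mulr1 -expRD [x + _]addrC subrK.
rewrite ler_wpM2l ?expR_ge0// lerBlDr -lerBlDl.
by have := expR_ge1Dx (y - x); lra.
Qed.

End geometric_sums.

Section variance_lower_bound.
Context {R : realType} (F : finType).

Definition upd r (b : {ffun 'I_r -> F}) (i : 'I_r) (c : F) : {ffun 'I_r -> F} :=
  [ffun j => if j == i then c else b j].

Lemma upd_id r (b : {ffun 'I_r -> F}) i : upd b i (b i) = b.
Proof. by apply/ffunP => j; rewrite ffunE; case: eqVneq => // ->. Qed.

Lemma updK r (b : {ffun 'I_r -> F}) i c c' : upd (upd b i c) i c' = upd b i c'.
Proof. by apply/ffunP => j; rewrite !ffunE; case: eqVneq. Qed.

Lemma updC r (b : {ffun 'I_r -> F}) i j c c' : i != j ->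
  upd (upd b i c) j c' = upd (upd b j c') i c.
Proof.
move=> ij; apply/ffunP => l; rewrite !ffunE.
by case: (eqVneq l j) => // ->; rewrite eq_sym (negPf ij).
Qed.

Lemma upd_eq r (b : {ffun 'I_r -> F}) i c : upd b i c i = c.
Proof. by rewrite ffunE eqxx. Qed.

Lemma upd_neq r (b : {ffun 'I_r -> F}) i j c : i != j -> upd b i c j = b j.
Proof. by rewrite ffunE eq_sym => /negPf ->. Qed.

Lemma sum_upd r (i : 'I_r) (c c' : F) (h : {ffun 'I_r -> F} -> R) :
  \sum_(b : {ffun 'I_r -> F} | b i == c) h b =
  \sum_(b : {ffun 'I_r -> F} | b i == c') h (upd b i c).
Proof.
rewrite (reindex_onto (fun b : {ffun 'I_r -> F} => upd b i c)
  (fun b : {ffun 'I_r -> F} => upd b i c')) /=; last first.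
  by move=> b /eqP <-; rewrite updK upd_id.
apply: eq_bigl => b; rewrite upd_eq eqxx/= updK.
by apply/eqP/eqP => [<-|<-]; rewrite ?upd_eq ?upd_id.
Qed.

Section site_swaps.
Variables (r : nat) (f : {ffun 'I_r -> F} -> R) (s : R) (u u' : F).
Variables (D K z : R).

(** In the application [f] is the Birkhoff sum of a concatenation of r words. Among the hypotheses
    on it, [mixed] is the substitute for independence: swaps at distant sites hardly influence each
    other. *)
Definition swap_gain (i : 'I_r) (b : {ffun 'I_r -> F}) : R :=
  f (upd b i u) - f (upd b i u').

Hypothesis gain_ge1 : forall i b, 1 <= swap_gain i b.
Hypothesis osc : forall i b c c', `|f (upd b i c) - f (upd b i c')| <= D.
Hypothesis D0 : 0 <= D.
Hypothesis K0 : 0 <= K.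
Hypothesis z01 : 0 <= z < 1.
Hypothesis mixed : forall i j b c c', i != j ->
  `|swap_gain j (upd b i c) - swap_gain j (upd b i c')|
    <= K * z ^+ ((i - j) + (j - i)).

Let W (b : {ffun 'I_r -> F}) : R := expR (s * f b).
Let Z : R := \sum_b W b.
Let M := expR (`|s| * D).

(* The exponential factor makes [g i] orthogonal, for the weight [W], to every
   function that ignores the swap of [u] and [u'] at site [i]. *)
Let g i (b : {ffun 'I_r -> F}) : R :=
  (b i == u)%:R - (b i == u')%:R * expR (s * swap_gain i b).

Let neq_uu' (i : 'I_r) (b : {ffun 'I_r -> F}) : (u' == u) = false.
Proof.
apply/eqP => e; have := gain_ge1 i b; rewrite /swap_gain e subrr.
by rewrite ler10.
Qed.

Let gain_upd i b c : swap_gain i (upd b i c) = swap_gain i b.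
Proof. by rewrite /swap_gain !updK. Qed.

Let W0 b : 0 < W b. Proof. exact: expR_gt0. Qed.

Let s_gain_le i b : s * swap_gain i b <= `|s| * D.
Proof.
by rewrite (le_trans (ler_norm _))// normrM ler_wpM2l//; exact: osc.
Qed.

Let M1 : 1 <= M. Proof. by rewrite -expR0 ler_expR mulr_ge0. Qed.

(** Summation by parts. If [b i = u'], then [W b * expR (s * swap_gain i b)] is the weight of b with
    u written at site i; after this substitution both terms run over the configurations with u at i.
    For constant h the sum vanishes. *)
Let sum_Wg i (h : {ffun 'I_r -> F} -> R) :
  \sum_b W b * h b * g i b =
  \sum_(b : {ffun 'I_r -> F} | b i == u) W b * (h b - h (upd b i u')).
Proof.
under eq_bigr do rewrite mulrBr.
rewrite sumrB.
have -> : \sum_(b : {ffun 'I_r -> F} | b i == u) W b * (h b - h (upd b i u')) =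
    \sum_(b : {ffun 'I_r -> F} | b i == u) W b * h b - \sum_(b : {ffun 'I_r -> F} | b i == u) W b * h (upd b i u').
  by rewrite -sumrB; apply: eq_bigr => b _; rewrite mulrBr.
congr (_ - _).
  rewrite [RHS]big_mkcond; apply: eq_bigr => b _.
  by case: (b i == u); rewrite ?mulr1 ?mulr0.
transitivity (\sum_(b : {ffun 'I_r -> F} | b i == u') W b * h b * expR (s * swap_gain i b)).
  rewrite [RHS]big_mkcond; apply: eq_bigr => b _.
  by case: (b i == u'); rewrite ?mul1r// mul0r mulr0.
rewrite (sum_upd i u' u); apply: eq_bigr => b /eqP bi.
rewrite gain_upd mulrAC; congr (_ * _); rewrite /W -expRD -mulrDr; congr (expR (s * _)).
by rewrite /swap_gain -bi upd_id addrC subrK.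
Qed.

(** Rewriting one letter changes the weight by a factor at most M, so u occupies site i with
    probability at least 1 / (#|F| M). *)
Let ZleU i : Z <= #|F|%:R * M * \sum_(b : {ffun 'I_r -> F} | b i == u) W b.
Proof.
rewrite /Z (partition_big (fun b : {ffun 'I_r -> F} => b i) predT)//=.
rewrite -mulrA mulr_natl -sumr_const; apply: ler_sum => c _.
rewrite (sum_upd i c u) mulr_sumr; apply: ler_sum => b /eqP bi.
rewrite /W -expRD ler_expR -lerBlDr -mulrBr (le_trans (ler_norm _))//.
by rewrite normrM ler_wpM2l// -{2}(upd_id b i).
Qed.

Let norm_g i b : `|g i b| <= M.
Proof.
rewrite /g; case: (eqVneq (b i) u) => [->|_]; case: (eqVneq _ u') => [e|_].
- by have := neq_uu' i b; rewrite -e eqxx.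
- by rewrite mul0r subr0 normr1 M1.
- by rewrite mul1r sub0r normrN ger0_norm ?expR_ge0// ler_expR.
- by rewrite mul0r subr0 normr0 expR_ge0.
Qed.

Let Z0 (b : {ffun 'I_r -> F}) : 0 < Z.
Proof.
by rewrite /Z (bigD1 b)//= ltr_pwDl// sumr_ge0// => *; exact: ltW.
Qed.


(** By [sum_Wg] the correlation is an average of the change of [g j] under a swap at site i. For i
    <> j this change comes only from [swap_gain j], so [mixed] controls it; on the diagonal the
    trivial bound M^2 is used. *)
Let corr (i j : 'I_r) : `|\sum_b W b * g j b * g i b| <=
  Z * ((M ^+ 2 + M * `|s| * K) * z ^+ ((i - j) + (j - i))).
Proof.
have [/andP[z0 z1]] := z01.
have M0 : 0 <= M by rewrite expR_ge0.
have Wsum (P : pred {ffun 'I_r -> F}) h c : (forall b, `|h b| <= c) -> 0 <= c ->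
    `|\sum_(b | P b) W b * h b| <= Z * c.
  move=> hc c0; rewrite (le_trans (ler_norm_sum _ _ _))//.
  rewrite /Z mulr_suml [leRHS](bigID P)/= ler_wpDr//.
    by apply: sumr_ge0 => b _; rewrite mulr_ge0// ltW.
  by apply: ler_sum => b _; rewrite normrM gtr0_norm// ler_wpM2l// ltW.
have [<-|ij] := eqVneq i j.
  rewrite subnn addn0 expr0 mulr1.
  under eq_bigr do rewrite -mulrA.
  apply: Wsum => [b|]; last by rewrite addr_ge0 ?mulr_ge0 ?exprn_ge0.
  rewrite normrM ler_wpDr ?mulr_ge0// expr2 ler_pM//.
rewrite (sum_Wg i (g j)); apply: Wsum => [b|]; last first.
  by rewrite mulr_ge0 ?addr_ge0 ?mulr_ge0 ?exprn_ge0.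
rewrite /g upd_neq// opprB addrC addrA subrK -mulrBr normrM.
apply: (@le_trans _ _ (M * `|s| * K * z ^+ (i - j + (j - i)))); last first.
  by rewrite ler_wpM2r ?exprn_ge0// lerDr exprn_ge0.
apply: (@le_trans _ _ (M * (`|s| * (K * z ^+ (i - j + (j - i)))))); last first.
  by rewrite !mulrA.
apply: (@le_trans _ _ `|expR (s * swap_gain j (upd b i u')) -
                        expR (s * swap_gain j b)|).
  by rewrite ler_piMl// normr_nat; case: (b j == u').
rewrite (le_trans (expR_lipschitz (s_gain_le _ _) (s_gain_le _ _)))//.
rewrite ler_wpM2l// -mulrBr normrM ler_wpM2l//.
by have := mixed b u' (b i) ij; rewrite upd_id.
Qed.


(** Twice Z^2 times the variance of a, written without dividing by Z. *)
Let dbl (a : {ffun 'I_r -> F} -> R) :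
  \sum_b \sum_b' W b * W b' * (a b - a b') ^+ 2 =
  2 * (Z * \sum_b W b * a b ^+ 2 - (\sum_b W b * a b) ^+ 2).
Proof.
transitivity (\sum_b \sum_b' (W b * a b ^+ 2 * W b' + W b * (W b' * a b' ^+ 2)
    - 2 * (W b * a b * (W b' * a b')))).
  by apply: eq_bigr => b _; apply: eq_bigr => b' _; ring.
under eq_bigr do rewrite sumrB big_split/= -!mulr_sumr.
rewrite sumrB big_split/= -!mulr_suml -mulr_sumr -mulr_suml -/Z.
ring.
Qed.

(** After division by Z, [(#|F| * M)^-1] is a lower bound for the covariance of f with one [g i],
    and the denominator is an upper bound per site for the variance of the sum of the [g i]. The
    leading 2 comes from the double sum in [variance_ge]. *)
Definition variance_rate : R :=
  2 * ((#|F|%:R * M)^-1 ^+ 2 / ((M ^+ 2 + M * `|s| * K) * (2 / (1 - z)))).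

(** A Cauchy-Schwarz bound of Cramer-Rao type: f - lam G has nonnegative variance, G has mean zero,
    and its covariance with f and its variance are both of order r. *)
Lemma variance_ge :
  r%:R * variance_rate * Z ^+ 2 <=
  \sum_b \sum_b' W b * W b' * (f b - f b') ^+ 2.
Proof.
have [/andP[z0 z1]] := z01.
have [b0 _|no] := pickP (fun _ : {ffun 'I_r -> F} => true); last first.
  by rewrite /Z !big_pred0// expr0n mulr0.
have Zp := Z0 b0.
have Mp : 0 < M by rewrite expR_gt0.
set C2 := (M ^+ 2 + M * `|s| * K) * (2 / (1 - z)).
have C2p : 0 < C2.
  by rewrite mulr_gt0 ?divr_gt0 ?subr_gt0// ltr_pwDl ?exprn_gt0 ?mulr_ge0 ?(ltW Mp).
have rsum x : r%:R * x = \sum_(i < r) x by rewrite sumr_const card_ord mulr_natl.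
have Fp : 0 < #|F|%:R :> R.
  by rewrite ltr0n; apply/card_gt0P; exists u.
set P := (#|F|%:R * M)^-1.
have Pp : 0 < P by rewrite invr_gt0 mulr_gt0.
pose G b := \sum_i g i b.
have sumWG h : \sum_b W b * h b * G b = \sum_i \sum_b W b * h b * g i b.
  by rewrite exchange_big /=; apply: eq_bigr => b _; rewrite mulr_sumr.
have EG : \sum_b W b * G b = 0.
  transitivity (\sum_b W b * 1 * G b); first by under [RHS]eq_bigr do rewrite mulr1.
  rewrite (sumWG (fun=> 1)) big1// => i _; rewrite (sum_Wg i (fun=> 1)) big1// => b _.
  by rewrite subrr mulr0.
have E1 : r%:R * (P * Z) <= \sum_b W b * f b * G b.
  rewrite sumWG rsum; apply: ler_sum => i _.
  rewrite sum_Wg; apply: (@le_trans _ _ (\sum_(b : {ffun 'I_r -> F} | b i == u) W b)).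
    by rewrite mulrC ler_pdivrMr ?mulr_gt0// mulrC ZleU.
  apply: ler_sum => b /eqP bi; rewrite ler_peMr ?(ltW (W0 b))//.
  by rewrite -{1}(upd_id b i) bi; exact: gain_ge1.
(* The decay in [corr] makes the second moment of G linear, not quadratic, in r. *)
have E2 : \sum_b W b * G b ^+ 2 <= r%:R * (C2 * Z).
  under eq_bigr do rewrite expr2 mulrA.
  rewrite sumWG rsum; apply: ler_sum => i _.
  have -> : \sum_b W b * G b * g i b = \sum_j \sum_b W b * g j b * g i b.
    rewrite exchange_big/=; apply: eq_bigr => b _.
    by rewrite -mulr_suml -mulr_sumr.
  apply: (@le_trans _ _ (\sum_(j < r) Z * ((M ^+ 2 + M * `|s| * K) *
     z ^+ ((i - j) + (j - i))))).
    by apply: ler_sum => j _; rewrite (le_trans (ler_norm _))// corr.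
  rewrite -!mulr_sumr mulrC /C2 -mulrA ler_wpM2r ?(ltW Zp)//.
  rewrite ler_wpM2l ?geo_sum_dist_le//.
  by rewrite addr_ge0 ?exprn_ge0 ?mulr_ge0 ?(ltW Mp).
(* This maximizes 2 lam P - lam^2 C2, with value P^2 / C2. *)
pose lam := P / C2.
pose a b := f b - lam * G b.
have Ea : \sum_b W b * a b = \sum_b W b * f b.
  rewrite /a; under eq_bigr do rewrite mulrBr mulrCA.
  by rewrite sumrB -mulr_sumr EG mulr0 subr0.
have Ea2 : \sum_b W b * a b ^+ 2 = \sum_b W b * f b ^+ 2 -
    2 * lam * (\sum_b W b * f b * G b) + lam ^+ 2 * (\sum_b W b * G b ^+ 2).
  rewrite !mulr_sumr -sumrB -big_split/=; apply: eq_bigr => b _.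
  by rewrite /a; ring.
have : 0 <= \sum_b \sum_b' W b * W b' * (a b - a b') ^+ 2.
  by rewrite sumr_ge0// => b _; rewrite sumr_ge0// => b' _;
     rewrite mulr_ge0 ?sqr_ge0// mulr_ge0// ltW.
rewrite !dbl Ea Ea2 /variance_rate -/C2 -/P.
move: E1 E2; set X1 := \sum_b W b * f b * G b; set X2 := \sum_b W b * G b ^+ 2.
set Y2 := \sum_b W b * f b ^+ 2; set Y1 := (\sum_b W b * f b) ^+ 2 => E1 E2.
have lamp : 0 < lam by rewrite divr_gt0.
move=> H.
have lE1 : lam * (r%:R * (P * Z)) <= lam * X1 by rewrite ler_wpM2l ?(ltW lamp).
have lE2 : lam ^+ 2 * X2 <= lam ^+ 2 * (r%:R * (C2 * Z)).
  by rewrite ler_wpM2l ?exprn_ge0 ?(ltW lamp).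
have id1 : lam ^+ 2 * (r%:R * (C2 * Z)) = lam * (r%:R * (P * Z)).
  by rewrite /lam; field; rewrite gt_eqF.
have id2 : r%:R * (2 * (P ^+ 2 / C2)) * Z ^+ 2 = 2 * (Z * (lam * (r%:R * (P * Z)))).
  by rewrite /lam; field; rewrite gt_eqF.
rewrite id2 ler_wpM2l//.
have : Z * (lam * (r%:R * (P * Z))) <= Z * (2 * lam * X1 - lam ^+ 2 * X2).
  by rewrite ler_wpM2l ?(ltW Zp)//; lra.
have -> : Z * (2 * lam * X1 - lam ^+ 2 * X2) =
   Z * Y2 - Z * (Y2 - 2 * lam * X1 + lam ^+ 2 * X2) by ring.
by move: H; rewrite pmulr_rge0//; lra.
Qed.

Lemma cosh_ge (x : R) : 2 + x ^+ 2 / 4 <= expR x + expR (- x).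
Proof.
wlog x0 : x / 0 <= x => [hw|].
  have [|/ltW x0] := leP 0 x; first exact: hw.
  by have := hw (- x); rewrite opprK sqrrN [expR _ + _]addrC oppr_ge0; apply.
have e1 : x / 2 <= expR (x / 2) - expR (- (x / 2)).
  have := expR_ge1Dx (x / 2).
  have : expR (- (x / 2)) <= 1 by rewrite -[leRHS]expR0 ler_expR; lra.
  lra.
have -> : expR x + expR (- x) = 2 + (expR (x / 2) - expR (- (x / 2))) ^+ 2.
  have h : expR (x / 2) * expR (- (x / 2)) = 1 by rewrite -expRD subrr expR0.
  have -> : expR x = expR (x / 2) ^+ 2.
    by rewrite expr2 -expRD; congr expR; field.
  have -> : expR (- x) = expR (- (x / 2)) ^+ 2.
    by rewrite expr2 -expRD; congr expR; field.
  by move: h; nra.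
rewrite lerD2l; have -> : x ^+ 2 / 4 = (x / 2) ^+ 2 by field.
by rewrite ler_sqr ?nnegrE//; lra.
Qed.

(** The product is the double sum of W b W b' exp(th (f b - f b')). Exchanging b and b' turns the
    exponential into a cosh, and cosh x >= 1 + x^2 / 8 brings in the variance. *)
Lemma partition_function_growth (th : R) :
  Z ^+ 2 * (1 + th ^+ 2 / 8 * (r%:R * variance_rate)) <=
  (\sum_b expR ((s + th) * f b)) * (\sum_b expR ((s - th) * f b)).
Proof.
have sumE : (\sum_b expR ((s + th) * f b)) * (\sum_b expR ((s - th) * f b)) =
    \sum_b \sum_b' W b * W b' * expR (th * (f b - f b')).
  rewrite mulr_suml; apply: eq_bigr => b _; rewrite mulr_sumr.
  apply: eq_bigr => b' _; rewrite /W -!expRD; congr expR; ring.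
have sumE' : \sum_b \sum_b' W b * W b' * expR (th * (f b - f b')) =
    \sum_b \sum_b' W b * W b' * expR (- (th * (f b - f b'))).
  rewrite exchange_big/=; apply: eq_bigr => b _; apply: eq_bigr => b' _.
  by rewrite -mulrN opprB [W b' * _]mulrC.
rewrite sumE.
set X := (leRHS); suff : Z ^+ 2 * (1 + th ^+ 2 / 8 * (r%:R * variance_rate)) <=
    (X + X) / 2 by have -> : (X + X) / 2 = X by field.
rewrite {2}/X sumE' {}/X -big_split mulr_suml/=.
under [leRHS]eq_bigr do rewrite -big_split mulr_suml/=.
apply: (@le_trans _ _ (\sum_b \sum_b' (W b * W b' + th ^+ 2 / 8 *
    (W b * W b' * (f b - f b') ^+ 2)))).
  under [leRHS]eq_bigr do rewrite big_split/= -!mulr_sumr.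
  rewrite big_split/= -mulr_sumr -mulr_suml -/Z mulrDr mulr1 expr2 lerD2l.
  by rewrite mulrCA ler_wpM2l ?divr_ge0 ?sqr_ge0// mulrC variance_ge.
apply: ler_sum => b _; apply: ler_sum => b' _.
have w0 : 0 <= W b * W b' by rewrite mulr_ge0 ?(ltW (W0 _)).
have := cosh_ge (th * (f b - f b')); rewrite exprMn; move: w0.
move: (W b * W b') (expR _) (expR _) ((f b - f b') ^+ 2) => w e1 e2 q w0 he.
have -> : w + th ^+ 2 / 8 * (w * q) = w * ((2 + th ^+ 2 * q / 4) / 2) by field.
have -> : (w * e2 + w * e1) / 2 = w * ((e1 + e2) / 2) by field.
by rewrite ler_wpM2l//; move: he; lra.
Qed.

End site_swaps.
End variance_lower_bound.

(** * Words, blocks and Birkhoff sums *)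

Section words.
Context {R : realType} {k : nat}.
Local Notation Omega := (Omega R k).
Implicit Types (x y : Omega) (n l r : nat).

Definition agree n x y := forall i, (i < n)%N -> x i = y i.

Definition shiftn n x : Omega := fun i => x (n + i)%N.

Lemma iter_left_shift n x : iter n left_shift x = shiftn n x.
Proof.
elim: n => [//|n IH]; rewrite iterS IH; apply/funext => i.
by rewrite /left_shift /shiftn addnS addSn.
Qed.

Definition word n : finType := {ffun 'I_n -> 'I_k.+1}.

(** The word is continued by [ord0]. Another continuation changes its Birkhoff sum by a bounded
    amount only, see [birkhoff_agree_self]. *)
Definition pt n (w : word n) : Omega :=
  fun i => if insub i is Some j then w j else ord0.

Definition word_of n x : word n := [ffun i : 'I_n => x i].

Lemma ptE n (w : word n) (i : 'I_n) : pt w i = w i.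
Proof. by rewrite /pt valK. Qed.

Lemma pt_out n (w : word n) i : (n <= i)%N -> pt w i = ord0.
Proof. by move=> ni; rewrite /pt insubF// ltnNge ni. Qed.

Lemma word_ofK n (w : word n) : word_of n (pt w) = w.
Proof. by apply/ffunP => i; rewrite ffunE ptE. Qed.

Lemma agree_pt n x : agree n (pt (word_of n x)) x.
Proof.
by move=> i ni; rewrite -[i]/(val (Ordinal ni)) ptE ffunE.
Qed.

Lemma agree_word_of n x y : agree n x y <-> word_of n x = word_of n y.
Proof.
split=> [xy|xy i ni]; first by apply/ffunP => i; rewrite !ffunE xy.
by have /ffunP/(_ (Ordinal ni)) := xy; rewrite !ffunE.
Qed.

Lemma agreeS m n x y : (m <= n)%N -> agree n x y -> agree m x y.
Proof. by move=> mn xy i im; apply: xy; apply: leq_trans mn. Qed.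

Lemma agree_shiftn n l x y : agree (l + n) x y -> agree n (shiftn l x) (shiftn l y).
Proof. by move=> xy i ni; apply: xy; rewrite ltn_add2l. Qed.

Definition blocks r l (b : {ffun 'I_r -> word l}) : Omega :=
  fun p => if insub (p %/ l)%N is Some j then pt (b j) (p %% l)%N else ord0.

Lemma blocksE r l (b : {ffun 'I_r -> word l}) (j : 'I_r) q : (q < l)%N ->
  blocks b (j * l + q)%N = pt (b j) q.
Proof.
move=> ql; rewrite /blocks divnMDl ?(leq_trans _ ql)// divn_small// addn0 valK.
by rewrite modnMDl modn_small.
Qed.

Lemma blocks_out r l (b : {ffun 'I_r -> word l}) p : (r * l <= p)%N ->
  blocks b p = ord0.
Proof.
move=> rp; rewrite /blocks; case: insubP => // j jr ej.
have [l0|l0] := posnP l; first by rewrite pt_out// l0.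
by move: jr; rewrite ltn_divLR// ltnNge rp.
Qed.

Lemma blocks_upd r l (b : {ffun 'I_r -> word l}) (i : 'I_r) c p :
  (p %/ l)%N != i -> blocks (upd b i c) p = blocks b p.
Proof.
move=> pi; rewrite /blocks; case: insubP => // j _ ej.
by rewrite upd_neq//; apply: contra pi => /eqP ->; rewrite ej.
Qed.

Definition unblocks r l (w : word (r * l)) : {ffun 'I_r -> word l} :=
  [ffun j : 'I_r => word_of l (shiftn (j * l) (pt w))].

Lemma pt_word_of_blocks r l (b : {ffun 'I_r -> word l}) :
  pt (word_of (r * l) (blocks b)) = blocks b.
Proof.
apply/funext => i; have [il|li] := ltnP i (r * l); first exact: agree_pt.
by rewrite pt_out// blocks_out.
Qed.

Lemma unblocksK r l (b : {ffun 'I_r -> word l}) :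
  unblocks (word_of (r * l) (blocks b)) = b.
Proof.
apply/ffunP => j; rewrite ffunE pt_word_of_blocks; apply/ffunP => q.
by rewrite ffunE /shiftn blocksE// ptE.
Qed.

Lemma word_of_blocksK r l (w : word (r * l)) :
  word_of (r * l) (blocks (unblocks w)) = w.
Proof.
apply/ffunP => i; rewrite ffunE -(ptE w).
have il := ltn_ord i; move: (val i) il => {}i il.
have l0 : (0 < l)%N by rewrite lt0n; apply/eqP => l0; move: il; rewrite l0 muln0.
have ir : (i %/ l < r)%N by rewrite ltn_divLR.
rewrite {1}(divn_eq i l) -[(i %/ l)%N]/(val (Ordinal ir)) blocksE ?ltn_mod//.
by rewrite ffunE agree_pt ?ltn_mod// /shiftn /= -divn_eq.
Qed.

End words.
Arguments word k n : clear implicits.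

Section birkhoff_sums.
Context {R : realType} {k : nat}.
Local Notation Omega := (Omega R k).
Local Notation word := (word k).
Implicit Types (x y : Omega) (n l r : nat).
Variable A : Omega -> R.

Definition birkhoff n x : R := \sum_(j < n) A (shiftn j x).

Lemma birkhoffD n l x : birkhoff (n + l) x = birkhoff n x + birkhoff l (shiftn n x).
Proof.
rewrite /birkhoff big_split_ord/=; congr (_ + _); apply: eq_bigr => j _.
by congr A; apply/funext => i; rewrite /shiftn addnA.
Qed.

(** Hoelder continuity read on cylinders, with z = 2^-theta ([hoelder_regular]). The case n = 0
    bounds the oscillation of A by C. *)
Definition regular (C z : R) :=
  forall n x y, agree n x y -> `|A x - A y| <= C * z ^+ n.

Definition partition_function n (s : R) : R :=
  \sum_(w : word n) expR (s * birkhoff n (pt (R := R) w)).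

Variables C z : R.
Hypothesis A_reg : regular C z.
Hypothesis C0 : 0 <= C.
Hypothesis z01 : 0 < z < 1.

Let z0 : 0 < z. Proof. by case/andP: z01. Qed.
Let z1 : z < 1. Proof. by case/andP: z01. Qed.
Let z01' : 0 <= z < 1. Proof. by rewrite ltW. Qed.

Let E := C / (1 - z).

Let E0 : 0 <= E. Proof. by rewrite divr_ge0 ?subr_ge0 ?(ltW z1). Qed.

(** Bounded distortion: the j-th terms are taken at points agreeing on N - j coordinates, so the
    errors form a geometric series whose bound is uniform in n. *)
Lemma birkhoff_agree N n x y : (n <= N)%N -> agree N x y ->
  `|birkhoff n x - birkhoff n y| <= E * z ^+ (N - n).
Proof.
move=> nN xy; rewrite /birkhoff -sumrB (le_trans (ler_norm_sum _ _ _))//.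
apply: (@le_trans _ _ (\sum_(j < n) C * z ^+ (N - j))).
  apply: ler_sum => j _; apply: A_reg; apply: agree_shiftn.
  by rewrite subnKC// (leq_trans _ nN)// ltnW.
rewrite -mulr_sumr /E mulrAC -mulrA ler_wpM2l//.
by rewrite geo_sum_rev_le.
Qed.

Lemma birkhoff_agree_self n x y : agree n x y ->
  `|birkhoff n x - birkhoff n y| <= E.
Proof. by move=> /(birkhoff_agree (leqnn n)); rewrite subnn mulr1. Qed.

Lemma birkhoff_osc n x y : `|birkhoff n x - birkhoff n y| <= n%:R * C.
Proof.
rewrite /birkhoff -sumrB (le_trans (ler_norm_sum _ _ _))//.
rewrite mulr_natl -[n in _ *+ n]card_ord -sumr_const; apply: ler_sum => j _.
by rewrite -[C]mulr1 -(expr0 z); apply: A_reg.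
Qed.

Section block_sums.
Variables (l : nat) (l0 : (0 < l)%N).

Let f r (b : {ffun 'I_r -> word l}) := birkhoff (r * l) (blocks (R := R) b).

Let blocks_agree r (b : {ffun 'I_r -> word l}) (i : 'I_r) c c' :
  agree (i * l) (blocks (R := R) (upd b i c)) (blocks (upd b i c')).
Proof.
move=> p pi; rewrite -(updK b i c c') [in RHS]blocks_upd//.
by rewrite neq_ltn ltn_divLR// pi.
Qed.

Let blocks_shift r (b : {ffun 'I_r -> word l}) (i : 'I_r) c c' :
  shiftn (i.+1 * l) (blocks (R := R) (upd b i c)) =
  shiftn (i.+1 * l) (blocks (upd b i c')).
Proof.
apply/funext => p; rewrite /shiftn -(updK b i c c') [in RHS]blocks_upd//.
by rewrite neq_ltn leq_divRL// leq_addr orbT.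
Qed.

Let f_split r (b : {ffun 'I_r -> word l}) (i : 'I_r) :
  f b = birkhoff (i.+1 * l) (blocks b) +
        birkhoff ((r - i.+1) * l) (shiftn (i.+1 * l) (blocks b)).
Proof. by rewrite -birkhoffD -mulnDl subnKC. Qed.

(** The part after block i is the same for both configurations. One E pays for the part before it,
    whose future has changed, and one E for each comparison of block i with [pt c] or [pt c']. *)
Let f_swap r (b : {ffun 'I_r -> word l}) (i : 'I_r) c c' :
  `|f (upd b i c) - f (upd b i c') -
    (birkhoff l (pt c) - birkhoff l (pt c'))| <= 3 * E.
Proof.
have loc c1 : `|birkhoff l (shiftn (i * l) (blocks (upd b i c1))) -
    birkhoff l (pt c1)| <= E.
  apply: birkhoff_agree_self => q ql.
  by rewrite /shiftn blocksE// upd_eq.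
have := loc c; have := loc c'.
have := birkhoff_agree_self (@blocks_agree r b i c c').
rewrite !(f_split _ i) (blocks_shift b i c c') mulSnr !birkhoffD.
rewrite !ler_norml => /andP[? ?] /andP[? ?] /andP[? ?].
by apply/andP; split; lra.
Qed.

(** The part after block i does not see c or c' and cancels in the mixed difference. The part up to
    the end of block i sees d and d' only across (j - i - 1) l coordinates; the factor 1 / z makes
    up for the missing 1. *)
Let f_mixed_lt r (b : {ffun 'I_r -> word l}) (i j : 'I_r) c c' d d' :
  (i < j)%N ->
  `|(f (upd (upd b i c) j d) - f (upd (upd b i c) j d')) -
    (f (upd (upd b i c') j d) - f (upd (upd b i c') j d'))|
  <= 2 * E / z * z ^+ ((i - j) + (j - i)).
Proof.
move=> ij.
have ji : j != i by rewrite -val_eqE gtn_eqF.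
have ind d1 : shiftn (i.+1 * l) (blocks (R := R) (upd (upd b i c) j d1)) =
              shiftn (i.+1 * l) (blocks (upd (upd b i c') j d1)).
  by rewrite ![upd (upd b i _) j d1]updC 1?eq_sym//; exact: blocks_shift.
have near c1 : `|birkhoff (i.+1 * l) (blocks (upd (upd b i c1) j d)) -
    birkhoff (i.+1 * l) (blocks (upd (upd b i c1) j d'))| <=
    E / z * z ^+ ((i - j) + (j - i)).
  rewrite (le_trans (birkhoff_agree _ (@blocks_agree r (upd b i c1) j d d')))//; first by rewrite leq_mul2r ij orbT.
  rewrite -mulrA ler_wpM2l// -(ler_pM2l z0) mulrA mulfV ?gt_eqF// mul1r -exprS.
  rewrite ler_wiXn2l ?(ltW z0) ?(ltW z1)//.
  rewrite -mulnBl (_ : (i - j + (j - i) = (j - i.+1).+1)%N); last by lia.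
  by rewrite ltnS leq_pmulr.
have := near c; have := near c'.
rewrite !(f_split _ i) !ind.
have -> : 2 * E / z * z ^+ ((i - j) + (j - i)) =
  E / z * z ^+ ((i - j) + (j - i)) + E / z * z ^+ ((i - j) + (j - i)) by lra.
set K := E / z * _.
rewrite !ler_norml => /andP[? ?] /andP[? ?].
by apply/andP; split; lra.
Qed.

Let f_mixed r (b : {ffun 'I_r -> word l}) (i j : 'I_r) c c' d d' :
  i != j ->
  `|(f (upd (upd b i c) j d) - f (upd (upd b i c) j d')) -
    (f (upd (upd b i c') j d) - f (upd (upd b i c') j d'))|
  <= 2 * E / z * z ^+ ((i - j) + (j - i)).
Proof.
move=> ij; have [|ji|/val_inj eij] := ltngtP i j; first exact: f_mixed_lt.
  have := @f_mixed_lt r b j i d d' c c' ji; rewrite addnC.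
  by rewrite ![upd (upd b j _) i _]updC 1?eq_sym// opprB addrACA [- _ - _]addrC addrACA opprB.
by rewrite eij eqxx in ij.
Qed.

Lemma partition_function_blocks r s :
  partition_function (r * l) s = \sum_(b : {ffun 'I_r -> word l}) expR (s * f b).
Proof.
rewrite /partition_function.
rewrite (reindex (fun b : {ffun 'I_r -> word l} => word_of (r * l) (blocks (R := R) b)))/=.
  by apply: eq_bigr => b _; rewrite pt_word_of_blocks.
exists (fun w => unblocks (R := R) w) => b _; first exact: unblocksK.
exact: word_of_blocksK.
Qed.

(** Otherwise [f_swap] makes every swap gain at least 1, and [partition_function_growth] gives a
    lower bound for the ratio that grows linearly in the number r of blocks, contradicting the bound
    B. *)
Lemma bounded_osc_of_partition_function s th B (u u' : word l) : th != 0 ->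
  (forall n, partition_function n (s + th) * partition_function n (s - th) <=
     B * partition_function n s ^+ 2) ->
  birkhoff l (pt u) - birkhoff l (pt u') <= 3 * E + 1.
Proof.
move=> th0 HB; rewrite leNgt; apply/negP => big.
pose D := 3 * E + l%:R * C.
have D0 : 0 <= D by apply: addr_ge0; apply: mulr_ge0; rewrite ?ler0n.
have K0 : 0 <= 2 * E / z by rewrite divr_ge0 ?(ltW z0)//; apply: mulr_ge0.
pose rate := variance_rate (word l) s D (2 * E / z) z.
have rate0 : 0 < rate.
  rewrite /rate /variance_rate mulr_gt0// divr_gt0 ?exprn_gt0 ?invr_gt0//.
    by rewrite mulr_gt0 ?expR_gt0// ltr0n; apply/card_gt0P; exists u.
  rewrite mulr_gt0 ?divr_gt0 ?subr_gt0// ltr_pwDl ?exprn_gt0 ?expR_gt0//.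
  by apply: mulr_ge0 => //; rewrite mulr_ge0 ?expR_ge0.
have key r : 1 + th ^+ 2 / 8 * (r%:R * rate) <= B.
  have Zp : 0 < partition_function (r * l) s.
    rewrite /partition_function (bigD1 [ffun=> ord0])//= ltr_pwDl ?expR_gt0//.
    by rewrite sumr_ge0// => *; exact: expR_ge0.
  rewrite -(ler_pM2r (exprn_gt0 2 Zp)) (le_trans _ (HB _))// mulrC.
  rewrite !partition_function_blocks.
  apply: (@partition_function_growth R (word l) r (@f r) s u u') => //.
  - move=> i b; change (1 <= f (upd b i u) - f (upd b i u')).
    have := f_swap b i u u'.
    by rewrite ler_norml => /andP[? ?]; lra.
  - move=> i b c c'; change (`|f (upd b i c) - f (upd b i c')| <= D).
    rewrite /D; have := f_swap b i c c'.
    have := birkhoff_osc l (pt c) (pt c').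
    rewrite !ler_norml => /andP[? ?] /andP[? ?].
    by apply/andP; split; lra.
  - by move=> i j b c c' ij; exact: f_mixed.
pose y := th ^+ 2 / 8 * rate.
have y0 : 0 < y by rewrite mulr_gt0// divr_gt0// exprn_even_gt0.
have := archi_boundP (ltW (divr_gt0 (ltr_pwDl ltr01 (normr_ge0 B)) y0)).
rewrite ltr_pdivrMr//; have := key (Num.bound ((1 + `|B|) / y)).
by rewrite mulrCA -/y; have := ler_norm B; lra.
Qed.

End block_sums.
End birkhoff_sums.

(** * Livsic's argument *)

Section livsic.
Context {R : realType} {k : nat}.
Local Notation Omega := (Omega R k).
Implicit Types (x y : Omega) (n l r : nat).
Variables (A : Omega -> R) (C z : R).
Hypothesis A_reg : regular A C z.
Hypothesis C0 : 0 <= C.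
Hypothesis z01 : 0 < z < 1.

Let z0 : 0 < z. Proof. by case/andP: z01. Qed.
Let z1 : z < 1. Proof. by case/andP: z01. Qed.
Let z01' : 0 <= z < 1. Proof. by rewrite ltW. Qed.
Let E := C / (1 - z).

Definition prep n y : Omega := fun i => if (i < n)%N then ord0 else y (i - n)%N.

Definition per n x : Omega := fun i => x (i %% n)%N.

Lemma prep0 y : prep 0 y = y.
Proof. by apply/funext => i; rewrite /prep subn0. Qed.

Lemma shiftn_prep l n y : (l <= n)%N -> shiftn l (prep n y) = prep (n - l) y.
Proof.
move=> ln; apply/funext => i; rewrite /shiftn /prep ltn_subRL.
by congr (if _ then _ else y _); lia.
Qed.

Lemma agree_prep n N y y' : agree N y y' -> agree (n + N) (prep n y) (prep n y').
Proof.
move=> yy i ni; rewrite /prep; case: ltnP => // ?; apply: yy.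
by rewrite ltn_subLR.
Qed.

Lemma birkhoff_per n m x : birkhoff A (m * n) (per n x) = m%:R * birkhoff A n (per n x).
Proof.
elim: m => [|m IH]; first by rewrite mul0n mul0r /birkhoff big_ord0.
rewrite mulSn birkhoffD.
have -> : shiftn n (per n x) = per n x.
  by apply/funext => i; rewrite /shiftn /per modnDl.
by rewrite IH -natr1 mulrDl mul1r addrC.
Qed.

Section bounded_oscillation.
Variable Q : R.
Hypothesis bosc : forall l (u u' : word k l),
  birkhoff A l (pt u) - birkhoff A l (pt u') <= Q.

Let c := A (fun=> ord0).

Let osc_le n x y : birkhoff A n x - birkhoff A n y <= Q + 2 * E.
Proof.
have := bosc (word_of n x) (word_of n y).
have := birkhoff_agree_self A_reg C0 z01 (@agree_pt R k n x).
have := birkhoff_agree_self A_reg C0 z01 (@agree_pt R k n y).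
rewrite -/E !ler_norml => /andP[? ?] /andP[? ?]; lra.
Qed.

(** Running through the period m times multiplies the difference by m, while the oscillation of
    Birkhoff sums stays bounded. *)
Let per_le n x y : birkhoff A n (per n x) <= birkhoff A n (per n y).
Proof.
rewrite leNgt; apply/negP; rewrite -subr_gt0; set d := _ - _ => d0.
have H m : m%:R * d <= `|Q + 2 * E|.
  rewrite (le_trans _ (ler_norm _))// mulrBr -!birkhoff_per; exact: osc_le.
have := archi_boundP (divr_ge0 (normr_ge0 (Q + 2 * E)) (ltW d0)).
by rewrite ltr_pdivrMr// ltNge H.
Qed.

Let per_sum n x : birkhoff A n (per n x) = n%:R * c.
Proof.
have -> : n%:R * c = birkhoff A n (per n (fun=> ord0)).
  by rewrite /birkhoff (eq_bigr (fun=> c))// sumr_const card_ord mulr_natl.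
by apply/eqP; rewrite eq_le !per_le.
Qed.

(** The transfer function will be the limit of [b n]: A - c summed along the backward orbit of y
    that always prepends [ord0]. The constant c is the value at the fixed point, hence by [per_sum]
    the mean of A over every period. *)
Let b n y := \sum_(j < n) (A (prep j.+1 y) - c).

Let b_birkhoff n y : b n y = birkhoff A n (prep n y) - n%:R * c.
Proof.
rewrite /b sumrB sumr_const card_ord mulr_natl; congr (_ - _).
rewrite (reindex_inj rev_ord_inj); apply: eq_bigr => j _ /=.
rewrite shiftn_prep 1?ltnW//; congr (A (prep _ y)).
by have := ltn_ord j; lia.
Qed.

(* The Birkhoff sums over the periods of (0^n y_0..y_(n-1)) and
   (0^n x_0 y_0..y_(n-1)), where y is the shift of x, are known exactly; their
   comparison leaves only the term [A x - c]. *)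
Let b_cohomology n x :
  `|b n (left_shift x) - b n x - (A x - c)| <= 3 * E * z ^+ n.
Proof.
pose y : Omega := left_shift x.
have bx : b n x + (A x - c) = birkhoff A n.+1 (prep n x) - n.+1%:R * c.
  rewrite -[n.+1]addn1 birkhoffD shiftn_prep// subnn prep0 b_birkhoff.
  rewrite [birkhoff A 1 x]/birkhoff big_ord1.
  have -> : shiftn (ord0 : 'I_1) x = x by apply/funext => i.
  by rewrite natrD mulrDl mul1r opprD addrACA.
have -> : b n (left_shift x) - b n x - (A x - c) = b n y - (b n x + (A x - c)).
  by rewrite [in RHS]opprD [RHS]addrA.
rewrite bx b_birkhoff.
pose p := per (n + n) (prep n y); pose p' := per (n.+1 + n) (prep n x).
have := per_sum (n + n) (prep n y); rewrite birkhoffD -/p => Hp.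
have := per_sum (n.+1 + n) (prep n x); rewrite birkhoffD -/p' => Hp'.
have a1 : agree (n + n) p (prep n y) by move=> i ni; rewrite /p /per modn_small.
have a2 : agree (n.+1 + n) p' (prep n x) by move=> i ni; rewrite /p' /per modn_small.
(* After 0^n and 0^n x_0 respectively, both periodic points continue with y_0..y_(n-1) and then
   0^n. *)
have a3 : agree (n + n) (shiftn n p) (shiftn n.+1 p').
  move=> i ni; rewrite /shiftn; have [i_n|n_i] := ltnP i n.
    rewrite a1 ?ltn_add2l// a2 ?ltn_add2l// /prep !ltnNge.
    rewrite leq_addr (leq_trans (leqnSn n)) ?leq_addr//= /y /left_shift.
    by congr x; lia.
  rewrite /p /p' /per.
  have -> : (n + i = (n + n) + (i - n))%N by lia.
  have -> : (n.+1 + i = (n.+1 + n) + (i - n))%N by lia.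
  rewrite !modnDl !modn_small ?ltn_subLR//; [|lia..].
  by rewrite /prep ltn_subLR// ni.
have := birkhoff_agree A_reg C0 z01 (leq_addl n n) a1.
have := birkhoff_agree A_reg C0 z01 (leq_addr n n.+1) a2.
have := birkhoff_agree A_reg C0 z01 (leq_addl n n) a3.
rewrite -/E addnK (_ : (n.+1 + n - n.+1 = n)%N); last by lia.
move: Hp Hp'; rewrite !natrD.
set e := E * z ^+ n; have -> : 3 * E * z ^+ n = e + e + e by rewrite /e; lra.
move=> ? ?; rewrite !ler_norml => /andP[? ?] /andP[? ?] /andP[? ?].
by apply/andP; split; lra.
Qed.

Let b_term j y : `|A (prep j.+1 y) - c| <= C * z ^+ j.
Proof.
apply: A_reg => i ij; rewrite /prep ltnS (ltnW ij)//.
Qed.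

Let b_cvg y : cvgn (b ^~ y).
Proof.
have -> : b ^~ y = series (fun j => A (prep j.+1 y) - c).
  by apply/funext => n; rewrite /b /series/= big_mkord.
apply: normed_cvg.
apply: (@series_le_cvg _ _ (geometric C z)).
- by move=> n; exact: normr_ge0.
- by move=> n; rewrite /geometric/= mulr_ge0 ?exprn_ge0 ?(ltW z0).
- by move=> n /=; exact: b_term.
- by apply: is_cvg_geometric_series; rewrite gtr0_norm.
Qed.

Let B y := limn (b ^~ y).

Let expn_cvg0 K : K * z ^+ n @[n --> \oo] --> (0 : R).
Proof.
by rewrite -(mulr0 K); apply: cvgMr; apply: cvg_expr; rewrite gtr0_norm.
Qed.

(** Prepending j + 1 letters adds j + 1 coordinates of agreement, so the termwise differences are
    geometric in j. *)
Let B_reg : regular B E z.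
Proof.
move=> N y y' yy.
have bN n : `|b n y - b n y'| <= E * z ^+ N.
  rewrite /b -sumrB (le_trans (ler_norm_sum _ _ _))//.
  apply: (@le_trans _ _ (\sum_(j < n) C * z ^+ N * z ^+ j)).
    apply: ler_sum => j _; rewrite opprB addrA subrK -mulrA -exprD.
    rewrite (le_trans (A_reg (agree_prep yy)))//.
    by rewrite ler_wpM2l// ler_wiXn2l ?(ltW z0) ?(ltW z1)//; lia.
  by rewrite -mulr_sumr /E [leRHS]mulrAC ler_wpM2l ?mulr_ge0 ?exprn_ge0 ?(ltW z0)// geo_sum_le.
have lim : `|b n y - b n y'| @[n --> \oo] --> `|B y - B y'|.
  by apply: cvg_norm; apply: cvgB; exact: b_cvg.
by apply: (cvgr_to_le lim); apply: nearW.
Qed.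

Lemma livsic : exists (c : R) (B : Omega -> R),
  regular B E z /\ forall x, A x = c + B (left_shift x) - B x.
Proof.
exists c, B; split => // x.
have l1 : b n (left_shift x) - b n x - (A x - c) @[n --> \oo] -->
    B (left_shift x) - B x - (A x - c).
  by apply: cvgB; [apply: cvgB; exact: b_cvg|exact: cvg_cst].
have l2 : b n (left_shift x) - b n x - (A x - c) @[n --> \oo] --> (0 : R).
  apply/cvgr0Pnorm_le => e e0.
  have /cvgr0Pnorm_le/(_ e e0) := expn_cvg0 (3 * E).
  apply: filterS => n /(le_trans _); apply.
  by rewrite (le_trans (b_cohomology _ _))// ler_norm.
have /subr0_eq h : B (left_shift x) - B x - (A x - c) = 0.
  exact: (cvg_unique _ l1 l2).
by rewrite -addrA h addrC subrK.
Qed.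

End bounded_oscillation.
End livsic.

(** * Hoelder continuity in terms of common initial words *)

Section hoelder.
Context {R : realType} {k : nat}.
Implicit Types (A : Omega R k -> R).

Lemma half_powR (theta : R) : 0 < theta -> 0 < 2^-1 `^ theta < (1 : R).
Proof.
move=> t0; rewrite powR_gt0 ?invr_gt0 ?ltr0n//=.
have := @gt0_ltr_powR R theta t0 2^-1 1; rewrite powR1; apply.
- by rewrite nnegrE invr_ge0.
- by rewrite nnegrE.
- by rewrite invf_lt1 ?ltr1n.
Qed.

Lemma half_powRX (theta : R) n : (2^-1 ^+ n) `^ theta = (2^-1 `^ theta) ^+ n.
Proof.
by rewrite -powR_mulrn ?invr_ge0// powRAC powR_mulrn// powR_ge0.
Qed.

Lemma hoelder_regular A : hoelder_continuous A ->
  exists C theta : R, [/\ 0 <= C, 0 < theta <= 1 & regular A C (2^-1 `^ theta)].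
Proof.
move=> [C [theta [/andP[t0 t1] AC]]]; exists `|C|, theta; split; rewrite ?t0//.
have /andP[z0 z1] := half_powR t0.
move=> n x y xy; apply: (le_trans (AC x y)).
apply: (@le_trans _ _ (`|C| * mdist x y `^ theta)).
  by rewrite ler_wpM2r ?powR_ge0// ler_norm.
rewrite ler_wpM2l//.
apply: (@le_trans _ _ ((2^-1 `^ theta) ^+ n.+1)).
  rewrite -half_powRX; apply: ge0_ler_powR; rewrite ?nnegrE ?(ltW t0)//.
  - exact: (Omega_dist_ge0 x y).
  - exact: (Omega_dist_le xy).
by rewrite ler_wiXn2l ?(ltW z0) ?(ltW z1).
Qed.

(** Points that first differ at index N are at distance 2^-(N+1) but agree on N coordinates only, so
    the constant absorbs a factor 2^theta. *)
Lemma regular_hoelder A C theta : 0 <= C -> 0 < theta <= 1 ->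
  regular A C (2^-1 `^ theta) -> hoelder_continuous A.
Proof.
move=> C0 t01 AC; have /andP[t0 t1] := t01.
have /andP[z0 z1] := half_powR t0.
exists (C / (2^-1 `^ theta)), theta; split=> // x y.
have [[n xyn]|nxy] := pselect (exists n, x n != y n); last first.
  have -> : x = y.
    by apply/funext => n; apply/eqP/negPn/negP => xyn; apply: nxy; exists n.
  by rewrite subrr normr0 mulr_ge0 ?powR_ge0// divr_ge0// ltW.
have [N xyN Nmin] := ex_minnP (ex_intro (fun n => x n != y n) n xyn).
apply: (@le_trans _ _ (C * (2^-1 `^ theta) ^+ N)).
  apply: AC => i iN; apply/eqP/negPn/negP => /Nmin.
  by rewrite leqNgt iN.
have -> : C * (2^-1 `^ theta) ^+ N = C / (2^-1 `^ theta) * (2^-1 `^ theta) ^+ N.+1.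
  by rewrite exprS mulrA divfK// gt_eqF.
rewrite ler_wpM2l ?divr_ge0 ?(ltW z0)//.
rewrite -half_powRX; apply: ge0_ler_powR; rewrite ?nnegrE ?(ltW t0)//.
- exact: (Omega_dist_ge0 x y).
- exact: (Omega_dist_ge xyN).
Qed.

End hoelder.

(** * Laws of finite-valued maps and Borel sets of Omega *)

Section law.
Context d (X : measurableType d) (R : realType).
Variable P : probability X R.

Definition law (F : finType) (f : X -> F) (a : F) : R := fine (P (f @^-1` [set a])).

Definition measurable_fibers (F : finType) (f : X -> F) :=
  forall a, measurable (f @^-1` [set a]).

Section finite_valued.
Variables (F : finType) (f : X -> F).
Hypothesis mf : measurable_fibers f.

Lemma law_ge0 a : 0 <= law f a.
Proof. exact/fine_ge0/measure_ge0. Qed.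

Lemma measurable_preimage_seq (s : seq F) : measurable (f @^-1` [set` s]).
Proof.
elim: s => [|a s IH].
  by rewrite (_ : _ @^-1` _ = set0)// -subset0 => x.
have -> : f @^-1` [set` a :: s] = f @^-1` [set a] `|` f @^-1` [set` s].
  apply/seteqP; split => x /=; rewrite inE.
    by case/orP => [/eqP|]; [left|right].
  by case=> [->|->]; rewrite ?eqxx ?orbT.
exact: measurableU.
Qed.

Lemma measurable_preimage_pred (Q : pred F) : measurable (f @^-1` [set a | Q a]).
Proof.
have -> : f @^-1` [set a | Q a] = f @^-1` [set` [seq a <- enum F | Q a]].
  by apply/seteqP; split => x /=; rewrite mem_filter mem_enum inE andbT.
exact: measurable_preimage_seq.
Qed.

Lemma law_pred (Q : pred F) :
  fine (P (f @^-1` [set a | Q a])) = \sum_(a | Q a) law f a.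
Proof.
have H (s : seq F) : uniq s -> fine (P (f @^-1` [set` s])) = \sum_(a <- s) law f a.
  elim: s => [_|a s IH /= /andP[nas us]].
    rewrite (_ : f @^-1` _ = set0) ?measure0 ?big_nil//.
    by rewrite -subset0 => x.
  have -> : f @^-1` [set` a :: s] = f @^-1` [set a] `|` f @^-1` [set` s].
    apply/seteqP; split => x /=; rewrite inE.
      by case/orP => [/eqP|]; [left|right].
    by case=> [->|->]; rewrite ?eqxx ?orbT.
  rewrite measureU//; last 2 first.
  - exact: measurable_preimage_seq.
  - by rewrite -subset0 => x [/= -> ais]; rewrite ais in nas.
  rewrite big_cons -IH// fineD// fin_num_measure//.
  exact: measurable_preimage_seq.
have -> : f @^-1` [set a | Q a] = f @^-1` [set` [seq a <- enum F | Q a]].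
  by apply/seteqP; split => x /=; rewrite mem_filter mem_enum inE andbT.
rewrite H; last by rewrite filter_uniq ?enum_uniq.
by rewrite big_filter big_enum_cond; apply: eq_bigl => a; rewrite inE.
Qed.

Lemma law_sum : \sum_a law f a = 1.
Proof.
rewrite -(law_pred predT) (_ : f @^-1` _ = setT) ?probability_setT//.
by apply/seteqP; split.
Qed.

Lemma measurable_fibers_comp (G : finType) (g : F -> G) :
  measurable_fibers (g \o f).
Proof.
move=> b; have -> : (g \o f) @^-1` [set b] = f @^-1` [set a | g a == b].
  by apply/seteqP; split => x /= /eqP.
exact: measurable_preimage_pred.
Qed.

Lemma law_comp (G : finType) (g : F -> G) : law (g \o f) =1 push g (law f).
Proof.
move=> b; rewrite /push -law_pred; congr (fine (P _)).
by apply/seteqP; split => x /= /eqP.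
Qed.

Lemma integrable_finite_valued (v : F -> R) : P.-integrable setT (EFin \o (v \o f)).
Proof.
rewrite (_ : EFin \o _ = fun x => (\sum_a (v a)%:E * (\1_(f @^-1` [set a]) x)%:E)%E).
  apply: integrable_sum => // a _; apply: integrableZl => //.
  exact: integrable_indic.
apply/funext => x /=; rewrite (bigD1 (f x))//= big1 ?adde0.
  by rewrite indicE mem_set//= mule1.
move=> a af; rewrite indicE memNset ?mule0// => /= e.
by rewrite e eqxx in af.
Qed.

Lemma Rintegral_finite_valued (v : F -> R) :
  \int[P]_x v (f x) = \sum_a law f a * v a.
Proof.
rewrite /Rintegral.
under eq_integral => x _.
  rewrite (_ : (v (f x))%:E = (\sum_a (v a)%:E * (\1_(f @^-1` [set a]) x)%:E)%E); first over.
  rewrite (bigD1 (f x))//= big1 ?adde0.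
    by rewrite indicE mem_set//= mule1.
  move=> a af; rewrite indicE memNset ?mule0// => /= e.
  by rewrite e eqxx in af.
rewrite integral_sum//; last first.
  by move=> a; apply: integrableZl => //; exact: integrable_indic.
have Ia a : (\int[P]_x ((v a)%:E * (\1_(f @^-1` [set a]) x)%:E))%E =
    (law f a * v a)%:E.
  rewrite integralZl//; last exact: integrable_indic.
  rewrite integral_indic// setIT mulrC EFinM /law fineK// ?fin_num_measure//.
by under eq_bigr do rewrite Ia; rewrite sumEFin.
Qed.

(** Applied to a regular potential and its values at [pt (word_of n x)], this gives integrability
    and computes the mean from cylinder probabilities. *)
Lemma Rintegral_approx (h : X -> R) (v : F -> R) (e : R) :
  measurable_fun setT h -> (forall x, `|h x - v (f x)| <= e) ->
  P.-integrable setT (EFin \o h) /\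
  `|\int[P]_x h x - \sum_a law f a * v a| <= e.
Proof.
move=> mh he.
have ih : P.-integrable setT (EFin \o h).
  apply: measurable_bounded_integrable => //; first by rewrite ltey_eq fin_num_measure.
  exists (\sum_a `|v a| + e); split; first exact: num_real.
  move=> M eM x _ /=; rewrite (le_trans _ (ltW eM))//.
  have -> : h x = v (f x) + (h x - v (f x)) by rewrite addrC subrK.
  rewrite (le_trans (ler_normD _ _))// lerD//.
  by rewrite (bigD1 (f x))//= lerDl sumr_ge0.
split=> //.
rewrite -Rintegral_finite_valued.
have iv := integrable_finite_valued v.
rewrite -RintegralB//.
apply: (le_trans (le_normr_Rintegral _ _)) => //.
  exact: (integrableB _ ih iv).
apply: (@le_trans _ _ (\int[P]_x e)); last first.
  by rewrite Rintegral_cst//= [P setT]probability_setT mulr1.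
apply: le_Rintegral => //.
- exact: (integrable_norm (integrableB _ ih iv)).
- apply: measurable_bounded_integrable => //; first by rewrite ltey_eq fin_num_measure.
  by exists `|e|; split => // M eM x _ /=; exact: ltW.
Qed.

End finite_valued.
End law.

Section Omega_measurability.
Context {R : realType} {k : nat}.
Local Notation Omega := (Omega R k).
Implicit Types (x y : Omega) (n : nat) (U B : set Omega).

Lemma open_agreeP U : open U <-> forall x, U x -> exists n, forall y, agree n x y -> U y.
Proof.
split=> [+ x Ux|H].
  rewrite openE => /(_ x Ux) /nbhs_ballP [e /= e0 eU].
  have [n ne] : exists n, (2^-1 : R) ^+ n < e.
    have /cvgr0Pnorm_lt/(_ e e0) : (2^-1 : R) ^+ n @[n --> \oo] --> (0 : R).
      by apply: cvg_expr; rewrite gtr0_norm ?invr_gt0// invf_lt1 ?ltr1n.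
    case=> n _ /(_ n (leqnn n)); rewrite /= ger0_norm ?exprn_ge0 ?invr_ge0// => ?.
    by exists n.
  exists n => y xy; apply: eU; rewrite ballEmdist /=.
  apply: le_lt_trans ne; apply: (le_trans (Omega_dist_le xy)).
  by rewrite ler_wiXn2l ?invr_ge0// invf_le1 ?ler1n.
rewrite openE => x /H [n nU]; apply/nbhs_ballP; exists (2^-1 ^+ n).
  by rewrite /= exprn_gt0 ?invr_gt0.
move=> y; rewrite ballEmdist /= => xy; apply: nU => i ni.
apply/eqP/negPn/negP => xyi; move: xy; rewrite ltNge => /negP; apply.
apply: le_trans (Omega_dist_ge xyi).
by rewrite ler_wiXn2l ?invr_ge0// invf_le1 ?ler1n.
Qed.

Lemma measurable_open U : open U -> measurable U.
Proof. by move=> oU; exact: sub_sigma_algebra. Qed.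

Lemma measurable_word_of n : measurable_fibers (@word_of R k n).
Proof.
move=> w; apply: measurable_open; apply/open_agreeP => x /= <-.
by exists n => y /agree_word_of ->.
Qed.

Lemma measurable_preimage_open (f : Omega -> Omega) :
  (forall U, open U -> measurable (f @^-1` U)) ->
  forall B, measurable B -> measurable (f @^-1` B).
Proof.
move=> of_ B mB.
have : measurable_fun setT f.
  apply: (measurability (@open Omega)) => // _ [U oU <-].
  by rewrite setTI; exact: of_.
by move=> /(_ measurableT _ mB); rewrite setTI.
Qed.

Lemma measurable_preimage_shiftn n B : measurable B -> measurable (shiftn n @^-1` B).
Proof.
apply: measurable_preimage_open => U /open_agreeP oU.
apply: measurable_open; apply/open_agreeP => x /oU [m mU].
by exists (n + m)%N => y xy; apply: mU; exact: agree_shiftn.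
Qed.

Lemma left_shiftE : left_shift = shiftn 1 :> (Omega -> Omega).
Proof. by []. Qed.

Lemma measurable_preimage_left_shift B :
  measurable B -> measurable (left_shift @^-1` B).
Proof. exact: (@measurable_preimage_shiftn 1). Qed.

Lemma measurable_regular (A : Omega -> R) C z : 0 < z < 1 -> regular A C z ->
  measurable_fun setT A.
Proof.
move=> /andP[z0 z1] AC.
apply: (measurability _ (measurable_realfun.RGenOpens.measurableE R)).
move=> _ [V [a [b Vab]] <-]; have oV : open V by rewrite Vab; exact: interval_open.
rewrite setTI; apply: measurable_open; apply/open_agreeP => x /= Vx.
move: oV; rewrite openE => /(_ _ Vx) /nbhs_ballP [e /= e0 eV].
have /cvgr0Pnorm_lt/(_ e e0) : C * z ^+ n @[n --> \oo] --> (0 : R).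
  by rewrite -(mulr0 C); apply: cvgMr; apply: cvg_expr; rewrite gtr0_norm.
case=> n _ /(_ n (leqnn n)) /= ne; exists n => y xy; apply: eV.
by rewrite /ball /= (le_lt_trans (AC _ _ _ xy))// (le_lt_trans (ler_norm _)).
Qed.

End Omega_measurability.

(** * The entropy is at most the normalized cylinder entropy *)

Section cylinder_approximation.
Context {R : realType} {k : nat}.
Local Notation Omega := (Omega R k).
Variable P : probability Omega R.
Implicit Types (B S : set Omega).

Definition cylinder_set n (Q : pred (word k n)) : set Omega :=
  [set x | Q (word_of n x)].

Lemma measurable_cylinder_set n (Q : pred (word k n)) :
  measurable (cylinder_set Q).
Proof. exact: (measurable_preimage_pred (@measurable_word_of R k n)). Qed.

Lemma cylinder_setW n m (Q : pred (word k n)) : (n <= m)%N ->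
  exists Q' : pred (word k m), cylinder_set Q' = cylinder_set Q.
Proof.
move=> nm; exists (fun w => Q (word_of n (pt (R := R) w))).
apply/seteqP; split => x; rewrite /cylinder_set /=;
  have -> // : word_of n (pt (R := R) (word_of m x)) = word_of n x;
  by apply/agree_word_of; apply: agreeS (@agree_pt R k m x).
Qed.

(** [Q m] selects the words of length m whose whole cylinder lies in U. Monotonicity in m makes
    continuity of measures applicable. *)
Lemma open_bigcup_cylinder (U : set Omega) : open U ->
  exists2 Q : forall m, pred (word k m), U = \bigcup_m cylinder_set (Q m) &
    nondecreasing_seq (fun m => cylinder_set (Q m)).
Proof.
move=> /open_agreeP oU.
exists (fun m w => `[< forall y : Omega, agree m (pt w) y -> U y >]).
  apply/seteqP; split => x.
    move/oU => [m mU]; exists m => //.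
    rewrite /cylinder_set /=; apply/asboolP => y xy; apply: mU => i im.
    by rewrite -xy// agree_pt.
  by move=> [m _ /asboolP]; apply; exact: agree_pt.
move=> m n mn; apply/subsetPset => x /asboolP h; apply/asboolP => y xy.
apply: h => i im; have ni := leq_trans im mn.
by rewrite agree_pt// -xy ?agree_pt.
Qed.

Definition symdiff B S := (B `\` S) `|` (S `\` B).

Lemma measurable_symdiff B S : measurable B -> measurable S ->
  measurable (symdiff B S).
Proof. by move=> mB mS; apply: measurableU; exact: measurableD. Qed.

Definition approximable B := forall e : R, 0 < e ->
  exists n (Q : pred (word k n)), (P (symdiff B (cylinder_set Q)) < e%:E)%E.

Lemma measure_sub2 B B1 B2 (e1 e2 : R) :
  measurable B -> measurable B1 -> measurable B2 -> B `<=` B1 `|` B2 ->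
  (P B1 < e1%:E)%E -> (P B2 < e2%:E)%E -> (P B < (e1 + e2)%:E)%E.
Proof.
move=> mB m1 m2 BB h1 h2.
apply: (@le_lt_trans _ _ (P (B1 `|` B2))).
  by apply: le_measure; rewrite ?inE//; exact: measurableU.
by rewrite (le_lt_trans (measureU2 _ _ _))// EFinD lteD.
Qed.

Lemma measure_bigsetU_le m (S : 'I_m -> set Omega) :
  (forall i, measurable (S i)) ->
  (P (\big[setU/set0]_(i < m) S i) <= \sum_(i < m) P (S i))%E.
Proof.
move=> mS; suff : measurable (\big[setU/set0]_(i < m) S i) /\
  (P (\big[setU/set0]_(i < m) S i) <= \sum_(i < m) P (S i))%E by case.
apply: (big_rec2 (fun B s => measurable B /\ (P B <= s)%E)).
  by rewrite measure0.
move=> i s B _ [mB PB]; split; first exact: measurableU.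
by rewrite (le_trans (measureU2 _ _ _))// leeD.
Qed.

Lemma approximableC B : approximable B -> approximable (~` B).
Proof.
move=> aB e e0; have [n [Q PQ]] := aB e e0; exists n, (predC Q).
have -> // : symdiff (~` B) (cylinder_set (predC Q)) = symdiff B (cylinder_set Q).
have -> : cylinder_set (predC Q) = ~` cylinder_set Q.
  by apply/seteqP; split => x /negP.
apply/seteqP; split => x; rewrite /symdiff /= => -[[h1 h2]|[h1 h2]].
- by right; split=> //; apply: contrapT.
- by left; split=> //; apply: contrapT.
- by right; split=> // h; apply: h2.
- by left; split=> // h; apply: h2.
Qed.

Lemma approximableU B1 B2 : measurable B1 -> measurable B2 ->
  approximable B1 -> approximable B2 -> approximable (B1 `|` B2).
Proof.
move=> m1 m2 a1 a2 e e0; have e20 : 0 < e / 2 by rewrite divr_gt0.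
have [n1 [Q1 P1]] := a1 _ e20; have [n2 [Q2 P2]] := a2 _ e20.
have [Q1' Q1E] := cylinder_setW Q1 (leq_maxl n1 n2).
have [Q2' Q2E] := cylinder_setW Q2 (leq_maxr n1 n2).
exists (maxn n1 n2), (predU Q1' Q2').
have -> : cylinder_set (predU Q1' Q2') = cylinder_set Q1 `|` cylinder_set Q2.
  by rewrite -Q1E -Q2E; apply/seteqP; split => x /= /orP.
have mQ1 := measurable_cylinder_set Q1; have mQ2 := measurable_cylinder_set Q2.
rewrite (splitr e); apply: measure_sub2 P1 P2.
- by apply: measurable_symdiff; exact: measurableU.
- exact: measurable_symdiff.
- exact: measurable_symdiff.
- move=> x [[[b1|b2] nS]|[[s1|s2] nB]].
  + by left; left; split=> // h; apply: nS; left.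
  + by right; left; split=> // h; apply: nS; right.
  + by left; right; split=> // h; apply: nB; left.
  + by right; right; split=> // h; apply: nB; right.
Qed.

Lemma approximable_cylinder_set n (Q : pred (word k n)) : approximable (cylinder_set Q).
Proof.
move=> e e0; exists n, Q; rewrite (_ : symdiff _ _ = set0) ?measure0 ?lte_fin//.
by rewrite -subset0 => x [[]|[]].
Qed.

Lemma approximable_bigcup (F : (set Omega)^nat) :
  (forall i, measurable (F i)) -> nondecreasing_seq F ->
  (forall i, approximable (F i)) -> approximable (\bigcup_i F i).
Proof.
move=> mF ndF aF e e0; have e20 : 0 < e / 2 by rewrite divr_gt0.
have mU : measurable (\bigcup_i F i) by exact: bigcupT_measurable.
have [i Pi] : exists i, (P (\bigcup_i F i `\` F i) < (e / 2)%:E)%E.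
  have : P (F n) @[n --> \oo] --> (fine (P (\bigcup_i F i)))%:E.
    by rewrite fineK ?fin_num_measure//; exact: nondecreasing_cvg_mu.
  move=> /fine_cvgP [_] /cvgrPdist_lt /(_ _ e20) [i _ /(_ i (leqnn i))] /= h.
  exists i; rewrite measureD ?ltey_eq ?fin_num_measure//.
  have FU : F i `<=` \bigcup_i F i by exact: bigcup_sup.
  rewrite setIidr//.
  rewrite -(fineK (fin_num_measure P _ mU)) -(fineK (fin_num_measure P _ (mF i))).
  by rewrite -EFinB lte_fin (le_lt_trans (ler_norm _)).
have [n [Q PQ]] := aF i _ e20; exists n, Q.
have mQ := measurable_cylinder_set Q.
rewrite (splitr e); apply: measure_sub2 Pi PQ => //.
- exact: measurable_symdiff.
- exact: measurableD.
- exact: measurable_symdiff.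
- move=> x [[Ux nQ]|[Qx nU]].
    have [Fx|nFx] := pselect (F i x); first by right; left.
    by left.
  by right; right; split=> // Fx; apply: nU; exists i.
Qed.

(** The approximable measurable sets form a sigma-algebra containing the open sets. Measurability is
    carried along because the union step compares measures. *)
Lemma approximable_measurable B : measurable B -> approximable B.
Proof.
move=> mB; suff [] : measurable B /\ approximable B by [].
move: B mB; apply: smallest_sub; first split.
- split; first exact: measurable0.
  rewrite (_ : set0 = cylinder_set (n := 0) pred0).
    exact: approximable_cylinder_set.
  by apply/seteqP; split.
- move=> B [mB aB]; rewrite setTD; split; first exact: measurableC.
  exact: approximableC.
- move=> F mF; pose G n := \big[setU/set0]_(i < n.+1) F i.
  have mG n : measurable (G n).
    by apply: bigsetU_measurable => i _; have [] := mF i.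
  rewrite -(bigcup_bigsetU_bigcup F).
  split; first exact: bigcupT_measurable.
  apply: approximable_bigcup => //.
    by move=> i j ij; apply/subsetPset; apply: subset_bigsetU.
  elim=> [|n IH].
    by rewrite big_ord1; case: (mF 0%N).
  by rewrite /= big_ord_recr; have [? ?] := mF n.+1; exact: (approximableU (mG n)).
- move=> U oU; split; first exact: measurable_open.
  have [Q UQ ndQ] := open_bigcup_cylinder oU.
  rewrite UQ; apply: approximable_bigcup => // m.
    exact: measurable_cylinder_set.
  exact: approximable_cylinder_set.
Qed.

End cylinder_approximation.

Section entropy_upper_bound.
Context {R : realType} {k : nat}.
Local Notation Omega := (Omega R k).
Variable mu : probability Omega R.
Hypothesis mu_inv : invariant_measure left_shift mu.

Definition block_entropy n : R := shannon (law mu (@word_of R k n)).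

Lemma measure_shiftn n B : measurable B -> mu (shiftn n @^-1` B) = mu B.
Proof.
move=> mB; elim: n => [|n IH]; first by congr (mu _); apply/seteqP; split.
rewrite -[RHS]IH -[RHS]mu_inv; last exact: measurable_preimage_shiftn.
by congr (mu _); apply/seteqP; split => x; rewrite /preimage/=;
  have -> // : shiftn n (left_shift x) = shiftn n.+1 x;
  apply/funext => i; rewrite /shiftn /left_shift addSn.
Qed.

Lemma law_shiftn (F : finType) (f : Omega -> F) n : measurable_fibers f ->
  law mu (f \o shiftn n) =1 law mu f.
Proof. by move=> mf a; rewrite /law comp_preimage measure_shiftn. Qed.

Lemma measurable_fibers_pair (F G : finType) (f : Omega -> F) (g : Omega -> G) :
  measurable_fibers f -> measurable_fibers g ->
  measurable_fibers (fun x => (f x, g x)).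
Proof.
move=> mf mg [a b].
rewrite (_ : _ @^-1` _ = f @^-1` [set a] `&` g @^-1` [set b]).
  exact: measurableI.
by apply/seteqP; split => x /=; [case=> -> ->|case=> -> ->].
Qed.

(** A word of length n + m is determined by its first n and last m letters, and by invariance the
    latter have the law of the m-cylinders. *)
Lemma block_entropyD n m :
  block_entropy (n + m) <= block_entropy n + block_entropy m.
Proof.
pose f (w : word k (n + m)) : word k n := word_of n (pt (R := R) w).
pose g (w : word k (n + m)) : word k m := word_of m (shiftn n (pt (R := R) w)).
have mw l := @measurable_word_of R k l.
have fE : f \o @word_of R k (n + m) = @word_of R k n.
  apply/funext => x /=; apply/agree_word_of.
  by apply: agreeS (@agree_pt R k (n + m) x); rewrite leq_addr.
have gE : g \o @word_of R k (n + m) = @word_of R k m \o shiftn n.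
  apply/funext => x /=; apply/agree_word_of.
  by apply: agree_shiftn; exact: agree_pt.
have -> : block_entropy n = shannon (push f (law mu (@word_of R k (n + m)))).
  by apply: eq_shannon => a; rewrite -law_comp// fE.
have -> : block_entropy m = shannon (push g (law mu (@word_of R k (n + m)))).
  by apply: eq_shannon => a; rewrite -law_comp// gE law_shiftn.
apply: shannon_joint; last 2 first.
- by move=> a; exact: law_ge0.
- exact: law_sum.
move=> w w' [ef eg]; apply/ffunP => i; rewrite -!(ptE (R := R)).
have [ni|ni] := ltnP i n.
  by have /agree_word_of/(_ _ ni) := ef.
have /agree_word_of/(_ (i - n)%N) := eg; rewrite /shiftn subnKC//; apply.
by rewrite ltn_subLR.
Qed.

Lemma block_entropy_ge0 n : 0 <= block_entropy n.
Proof.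
apply: shannon_ge0 => [a|]; first exact: law_ge0.
by apply: law_sum; exact: measurable_word_of.
Qed.

Lemma block_entropyM n q : block_entropy (q * n) <= q%:R * block_entropy n.
Proof.
elim: q => [|q IH].
  rewrite mul0n mul0r /block_entropy /shannon oppr_le0.
  have mw := @measurable_word_of R k 0.
  apply: sumr_ge0 => w _; have -> : law mu (@word_of R k 0) w = 1.
    rewrite -(law_sum mu mw) (bigD1 w)//= big1 ?addr0// => w' /eqP; case.
    by apply/ffunP => -[].
  by rewrite ln1 mulr0.
by rewrite mulSn (le_trans (block_entropyD _ _))// -natr1 mulrDl mul1r addrC lerD2r.
Qed.

Section partition.
Variables (m : nat) (Pt : 'I_m -> set Omega).
Hypothesis mP : measurable_partition Pt.

Lemma partition_index : {f : Omega -> 'I_m | forall i x, Pt i x <-> f x = i}.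
Proof.
case: mP => _ tP cP.
have ex x : {i | Pt i x}.
  by apply: cid; have : setT x by []; rewrite -cP => -[i _ ?]; exists i.
exists (fun x => projT1 (ex x)) => i x; case: (ex x) => j Pj /=.
split=> [Pi|<-//].
by apply: (tP j i) => //; exists x.
Qed.

Let idx := projT1 partition_index.

Let idxP i x : Pt i x <-> idx x = i.
Proof. exact: (projT2 partition_index). Qed.

Let measurable_idx : measurable_fibers idx.
Proof.
move=> i; have -> : idx @^-1` [set i] = Pt i.
  by apply/seteqP; split => x /idxP.
by case: mP.
Qed.

Let name n x : {ffun 'I_n -> 'I_m} := [ffun j : 'I_n => idx (shiftn j x)].

Let join_cellE n w : join_cell left_shift Pt w = name n @^-1` [set w].
Proof.
apply/seteqP; split => x /=.
  move=> h; apply/ffunP => j; rewrite ffunE; apply/idxP.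
  by have := h j I; rewrite /= iter_left_shift.
move=> <- j _ /=; rewrite iter_left_shift ffunE; exact/idxP.
Qed.

Let measurable_name n : measurable_fibers (name n).
Proof.
move=> w; rewrite -join_cellE; apply: fin_bigcap_measurable => // j _.
have -> : iter j left_shift @^-1` Pt (w j) = shiftn j @^-1` Pt (w j).
  by apply/seteqP; split => x /=; rewrite iter_left_shift.
by apply: measurable_preimage_shiftn; case: mP.
Qed.

Lemma join_entropyE n : join_entropy left_shift mu Pt n = shannon (law mu (name n)).
Proof.
by rewrite /join_entropy /shannon; under eq_bigr do rewrite join_cellE.
Qed.

Let error K (guess : word k K -> 'I_m) : R :=
  fine (mu [set x | idx x != guess (word_of K x)]).

Let measurable_error K (guess : word k K -> 'I_m) :
  measurable [set x | idx x != guess (word_of K x)].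
Proof.
have := measurable_preimage_pred (measurable_fibers_pair measurable_idx
  (@measurable_word_of R k K)) (fun p => p.1 != guess p.2).
by [].
Qed.

(* Coding the names by the cylinders and a guess which is right except with
   small probability costs little: Gibbs' inequality is applied to the
   subprobability that draws the word from [mu] and each letter of the name
   from a kernel concentrated on the guess. *)
Let name_entropy_le K (guess : word k K -> 'I_m) (eta : R) n : 0 < eta < 1 ->
  shannon (law mu (name n)) <= block_entropy (n + K) +
    n%:R * (- ln (1 - eta) + ln (m%:R / eta) * error guess).
Proof.
move=> /andP[eta0 eta1].
have m0 : (0 < m)%N.
  by case: m (idx point) => // -[].
have m0' : 0 < m%:R :> R by rewrite ltr0n.
(* The mass eta is spread over all m letters, so the kernel is positive everywhere: a right guess
   costs at most - ln (1 - eta), a wrong one ln (m / eta). *)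
pose kap (i i0 : 'I_m) : R := (if i == i0 then 1 - eta else 0) + eta / m%:R.
have kap0 i i0 : 0 < kap i i0.
  by rewrite ltr_wpDl ?divr_gt0//; case: ifP => // _; rewrite subr_ge0 ltW.
have kap1 i0 : \sum_i kap i i0 = 1.
  rewrite big_split/= -big_mkcond big_pred1_eq sumr_const card_ord.
  have -> : eta / m%:R *+ m = eta by rewrite -mulr_natr divfK ?gt_eqF.
  by rewrite subrK.
pose J x := (name n x, word_of (n + K) x).
have mJ : measurable_fibers J.
  by apply: measurable_fibers_pair => //; exact: measurable_word_of.
(* The guess at time j reads the K letters from j on, whence words of length n + K. *)
pose gs (w : word k (n + K)) (j : 'I_n) :=
  guess (word_of K (shiftn j (pt (R := R) w))).
pose L := law mu (@word_of R k (n + K)).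
pose q (p : {ffun 'I_n -> 'I_m} * word k (n + K)) : R :=
  L p.2 * \prod_j kap (p.1 j) (gs p.2 j).
have prod0 p w : 0 < \prod_j kap (p j) (gs w j) by apply: prodr_gt0.
have L0 w : 0 <= L w by exact: law_ge0.
have LJ : L =1 push snd (law mu J) by move=> w; rewrite -law_comp.
have J0 p : 0 <= law mu J p by exact: law_ge0.
have Lp p : 0 < law mu J p -> 0 < L p.2.
  by move=> Jp; rewrite LJ (lt_le_trans Jp)// le_push.
apply: (@le_trans _ _ (shannon (law mu J))).
  have -> : shannon (law mu (name n)) = shannon (push fst (law mu J)).
    by apply: eq_shannon => a; rewrite -law_comp.
  exact: shannon_push.
apply: (le_trans (@gibbs R _ (law mu J) q J0 _ _ _)).
- by move=> p; rewrite mulr_ge0// ltW.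
- by move=> p /Lp ?; rewrite mulr_gt0.
- rewrite law_sum// (_ : \sum_a q a = \sum_w \sum_p q (p, w)); last first.
    by rewrite exchange_big pair_bigA; apply: eq_bigr => -[].
  have -> : 1 = \sum_w L w by rewrite law_sum//; exact: measurable_word_of.
  apply: ler_sum => w _; rewrite /q /= -mulr_sumr.
  rewrite -(bigA_distr_bigA (fun j i => kap i (gs w j))) /=.
  by rewrite big1 ?mulr1// => j _; rewrite kap1.
have lnq p : 0 < law mu J p ->
    ln (q p) = ln (L p.2) + \sum_j ln (kap (p.1 j) (gs p.2 j)).
  move=> /Lp Lp0; rewrite lnM ?posrE//; congr (_ + _).
  suff : 0 < \prod_j kap (p.1 j) (gs p.2 j) /\
      ln (\prod_j kap (p.1 j) (gs p.2 j)) = \sum_j ln (kap (p.1 j) (gs p.2 j)) by case.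
  apply: (big_rec2 (fun x y => 0 < x /\ ln x = y)); rewrite ?ln1//.
  by move=> i x y _ [y0 <-]; rewrite mulr_gt0// lnM ?posrE.
have -> : - \sum_p law mu J p * ln (q p) =
    - \sum_p law mu J p * ln (L p.2) +
    \sum_j - \sum_p law mu J p * ln (kap (p.1 j) (gs p.2 j)).
  rewrite [X in _ = _ + X]sumrN -opprD; congr (- _).
  rewrite exchange_big -big_split/=; apply: eq_bigr => p _.
  have := J0 p; rewrite le_eqVlt => /predU1P[<-|/lnq ->].
    by rewrite !mul0r add0r big1// => j _; rewrite mul0r.
  by rewrite mulrDr mulr_sumr.
have -> : - \sum_p law mu J p * ln (L p.2) = block_entropy (n + K).
  rewrite -(sum_push snd (law mu J) (fun w => ln (L w))).
  by congr (- _); apply: eq_bigr => w _; rewrite -LJ.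
rewrite lerD2l mulr_natl -[n in _ *+ n]card_ord -sumr_const; apply: ler_sum => j _.
pose J0' x := (idx x, word_of K x).
have mJ0 : measurable_fibers J0'.
  by apply: measurable_fibers_pair => //; exact: measurable_word_of.
(* By invariance the joint law of the j-th letter and the K letters used to guess it does not depend
   on j. *)
pose g (p : {ffun 'I_n -> 'I_m} * word k (n + K)) :=
  (p.1 j, word_of K (shiftn j (pt (R := R) p.2))).
have gJ : g \o J = J0' \o shiftn j.
  apply/funext => x; rewrite /g /J /J0' /= ffunE; congr pair.
  apply/agree_word_of; apply: agree_shiftn.
  by apply: agreeS (@agree_pt R k (n + K) x); rewrite leq_add2r ltnW.
have -> : \sum_p law mu J p * ln (kap (p.1 j) (gs p.2 j)) =
    \sum_p law mu J0' p * ln (kap p.1 (guess p.2)).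
  rewrite -(sum_push g (law mu J) (fun p => ln (kap p.1 (guess p.2)))).
  by apply: eq_bigr => p _; rewrite -law_comp// gJ law_shiftn.
have -> : error guess = \sum_(p | p.1 != guess p.2) law mu J0' p.
  by rewrite -law_pred.
have J00 p : 0 <= law mu J0' p by exact: law_ge0.
apply: (@le_trans _ _ (\sum_p (law mu J0' p * - ln (1 - eta) +
   (if p.1 != guess p.2 then ln (m%:R / eta) * law mu J0' p else 0)))); last first.
  by rewrite big_split/= -mulr_suml law_sum// mul1r -big_mkcond mulr_sumr.
have eta1' : 0 < 1 - eta by rewrite subr_gt0.
have lneta : 0 <= - ln (1 - eta) by rewrite oppr_ge0 ln_le0// gerBl ltW.
rewrite -sumrN; apply: ler_sum => p _; case: ifPn => [ne|/negPn/eqP e].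
  rewrite /kap (negPf ne) add0r -[m%:R / eta]invf_div lnV ?posrE ?divr_gt0//.
  by rewrite [leRHS]addrC mulNr [ln _ * _]mulrC lerDl mulr_ge0.
rewrite addr0 -mulrN ler_wpM2l// lerN2 ler_ln ?posrE// /kap e eqxx.
by rewrite lerDl divr_ge0// ltW.
Qed.

(** Each cell is approximated by a cylinder set, all of a common length K, and the guess picks a
    cell whose approximation contains the word. It fails only inside the symmetric differences. *)
Let exists_guess (e : R) : 0 < e -> exists K (guess : word k K -> 'I_m), error guess < e.
Proof.
move=> e0; pose d := e / m.+1%:R; have d0 : 0 < d by rewrite divr_gt0.
have ap i : {nQ : {n : nat & pred (word k n)} |
    (mu (symdiff (Pt i) (cylinder_set (R := R) (projT2 nQ))) < d%:E)%E}.
  apply: cid; have [mPt _ _] := mP.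
  have [n [Q PQ]] := approximable_measurable mu (mPt i) d0.
  by exists (existT _ n Q).
pose n_ i := projT1 (projT1 (ap i)).
pose K := \max_i n_ i.
have Qw i : {Q : pred (word k K) |
    cylinder_set (R := R) Q = cylinder_set (projT2 (projT1 (ap i)))}.
  by apply: cid; apply: cylinder_setW; exact: leq_bigmax.
pose Q i := projT1 (Qw i).
pose S i := symdiff (Pt i) (cylinder_set (R := R) (Q i)).
have mPt i : measurable (Pt i) by case: mP.
have mS i : measurable (S i).
  by apply: measurable_symdiff => //; exact: measurable_cylinder_set.
have muS i : (mu (S i) <= d%:E)%E.
  by rewrite /S /Q (projT2 (Qw i)) ltW// (projT2 (ap i)).
pose guess (w : word k K) := odflt (idx point) [pick i | Q i w].
exists K, guess; pose Er := [set x | idx x != guess (word_of K x)].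
change (fine (mu Er) < e).
have ErS : Er `<=` \big[setU/set0]_(i < m) S i.
  move=> x /= ne; apply: contrapT => nS.
  have {}nS i : ~ S i x by move=> Sx; apply: nS; rewrite (bigD1 i)//=; left.
  have Px : Pt (idx x) x by apply/idxP.
  move/negP : ne; apply; apply/eqP; rewrite /guess; case: pickP => [j Qj|/(_ (idx x))] /=.
    apply/idxP; apply: contrapT => nPj; apply: (nS j); right; split => //.
  move/negP => nQ; exfalso; apply: (nS (idx x)); left; split => //.
have muE : (mu Er <= \sum_(i < m) mu (S i))%E.
  apply: (le_trans (le_measure mu _ _ ErS)); rewrite ?inE.
  - exact: measurable_error.
  - exact: bigsetU_measurable.
  - exact: measure_bigsetU_le.
have {}muE : (mu Er <= (m%:R * d)%:E)%E.
  rewrite (le_trans muE)// (le_trans (lee_sum _ (fun i _ => muS i)))//.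
  by rewrite sumEFin sumr_const card_ord mulr_natl.
rewrite -lte_fin fineK ?fin_num_measure//; last exact: measurable_error.
rewrite (le_lt_trans muE)// lte_fin /d mulrCA -[ltRHS]mulr1 ltr_pM2l//.
by rewrite ltr_pdivrMr// mul1r ltr_nat.
Qed.

(** Along the multiples q n, names cost at most q H_n + H_K plus an arbitrarily small amount per
    letter. After division by q n the term H_K disappears, while n stays fixed. *)
Lemma partition_entropy_le n : (0 < n)%N ->
  partition_entropy left_shift mu Pt <= block_entropy n / n%:R.
Proof.
move=> n0; rewrite /partition_entropy.
set F := fun n => _.
(* For a divergent sequence [limn] is the default value 0, which satisfies the bound. *)
have [cF|/dvgP ->] := pselect (cvgn F); last by rewrite divr_ge0// block_entropy_ge0.
apply/ler_addgt0Pr => e e0; have e40 : 0 < e / 4 by rewrite divr_gt0.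
(* Chosen so that - ln (1 - eta) = e / 4. *)
pose eta := 1 - expR (- (e / 4)).
have eta01 : 0 < eta < 1.
  by rewrite subr_gt0 gtrBl expR_gt0 andbT -[ltRHS]expR0 ltr_expR oppr_lt0.
have /andP[eta0 eta1] := eta01.
have m1 : 1 <= m%:R :> R by rewrite ler1n; case: m (idx point) => // -[].
have l0 : 0 <= ln (m%:R / eta).
  by rewrite ln_ge0// ler_pdivlMr// mul1r (le_trans (ltW eta1)).
have [K [guess err]] := @exists_guess ((e / 4) / (1 + ln (m%:R / eta)))
  (divr_gt0 e40 (ltr_pwDl ltr01 l0)).
have c_le : - ln (1 - eta) + ln (m%:R / eta) * error guess <= e / 2.
  have -> : - ln (1 - eta) = e / 4 by rewrite /eta opprB addrC subrK expRK opprK.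
  have err0 : 0 <= error guess by exact: fine_ge0.
  have : (1 + ln (m%:R / eta)) * error guess <= e / 4.
    by rewrite mulrC -ler_pdivlMr ?ltr_pwDl// ltW.
  by lra.
move/cvgrPdist_lt : cF => /(_ _ e40) [N0 _ HN].
(* Large enough for q n >= N0 and for H_K / (q n) <= e / 4. *)
pose q := (N0 + Num.bound (block_entropy K / (e / 4))).+1.
have nN : (N0 <= q * n)%N.
  by rewrite (leq_trans _ (leq_pmulr _ n0))// /q leqW// leq_addr.
have := HN _ nN; rewrite /= ltr_norml => /andP[_ HL].
have N1 : 0 < (q * n)%:R :> R by rewrite ltr0n muln_gt0 n0.
have FN : F (q * n)%N <= block_entropy n / n%:R + e / 4 + e / 2.
  rewrite /F ler_pdivrMr// join_entropyE.
  rewrite (le_trans (name_entropy_le guess _ eta01))//.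
  rewrite (le_trans (lerD (block_entropyD _ _) (lexx _)))//.
  rewrite 2!mulrDl; apply: lerD; first apply: lerD.
  - rewrite (le_trans (block_entropyM _ _))// natrM mulrCA.
    by rewrite divfK ?pnatr_eq0 ?gtn_eqF// mulrC.
  - rewrite mulrC -ler_pdivrMr//.
    have bd := archi_boundP (divr_ge0 (block_entropy_ge0 K) (ltW e40)).
    apply: (le_trans (ltW bd)); rewrite ler_nat.
    by rewrite (leq_trans _ (leq_pmulr _ n0))// /q leqW// leq_addl.
  - by rewrite mulrC ler_wpM2r// ltW.
by lra.
Qed.

End partition.

Lemma entropy_le n : (0 < n)%N ->
  (entropy left_shift mu <= (block_entropy n / n%:R)%:E)%E.
Proof.
move=> n0; apply: ge_ereal_sup => _ [m [Pt [mP ->]]].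
by rewrite lee_fin; exact: partition_entropy_le.
Qed.

End entropy_upper_bound.

(** * Kolmogorov extension *)

Section pushforward_probability.
Context {R : realType} d (T : measurableType d) d' (T' : measurableType d').

Lemma pushforward_probability (P : probability T R) (f : T -> T') :
  measurable_fun setT f ->
  exists rho : probability T' R, forall B, rho B = P (f @^-1` B).
Proof.
move=> mf.
pose X : {mfun T >-> T'} := HB.pack f (isMeasurableFun.Build _ _ _ _ f mf).
by exists (distribution P X).
Qed.

End pushforward_probability.

Section cylinders_determine.
Context {R : realType} {k : nat}.
Local Notation Omega := (Omega R k).

Lemma measurable_fun_Omega d (T : measurableType d) (f : T -> Omega) :
  (forall n, measurable_fibers (fun u => word_of n (f u))) -> measurable_fun setT f.
Proof.
move=> mf; apply: (measurability (@open Omega)) => // _ [U oU <-].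
have [Q -> _] := open_bigcup_cylinder oU.
rewrite setTI preimage_bigcup; apply: bigcupT_measurable => m.
exact: (measurable_preimage_pred (mf m)).
Qed.

(** Open sets are a generating pi-system, and each one is an increasing union of cylinder sets. *)
Lemma probability_ext (P Q : probability Omega R) :
  (forall n, law P (@word_of R k n) =1 law Q (@word_of R k n)) ->
  forall B, measurable B -> P B = Q B.
Proof.
move=> PQ.
have PQc n (q : pred (word k n)) :
    P (cylinder_set (R := R) q) = Q (cylinder_set q).
  have mq := measurable_cylinder_set (R := R) q.
  rewrite -(fineK (fin_num_measure P _ mq)) -(fineK (fin_num_measure Q _ mq)).
  congr (_%:E); have mw := @measurable_word_of R k n.
  rewrite (law_pred P mw) (law_pred Q mw); apply: eq_bigr => w _.
  exact: PQ.
apply: (measure_unique (@open Omega) (fun=> setT)) => //.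
- by move=> A B; exact: openI.
- by move=> i; exact: openT.
- by rewrite bigcup_const//; exists 0%N.
- move=> U oU; have [q Uq ndq] := open_bigcup_cylinder oU.
  have mq m : measurable (cylinder_set (R := R) (q m)) := measurable_cylinder_set _.
  have mU : measurable (\bigcup_m cylinder_set (R := R) (q m)).
    exact: bigcupT_measurable.
  have cP := nondecreasing_cvg_mu (mu := P) mq mU ndq.
  have cQ := nondecreasing_cvg_mu (mu := Q) mq mU ndq.
  rewrite Uq -(cvg_lim (@ereal_hausdorff R) cP) -(cvg_lim (@ereal_hausdorff R) cQ).
  by apply: congr_lim; apply/funext => m /=; exact: PQc.
- by move=> i; rewrite ltey_eq fin_num_measure.
Qed.

Lemma invariant_measureP (P : probability Omega R) :
  (forall n, law P (@word_of R k n \o left_shift) =1 law P (@word_of R k n)) ->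
  invariant_measure left_shift P.
Proof.
move=> inv B mB.
have mT : measurable_fun setT (@left_shift R k).
  by move=> _ C mC; rewrite setTI; exact: measurable_preimage_left_shift.
have [Q QE] := pushforward_probability P mT.
rewrite -QE; apply: probability_ext mB => n w.
by rewrite -inv /law QE.
Qed.

End cylinders_determine.

Definition unit_lebesgue (R : realType) : set (measurableTypeR R) -> \bar R :=
  mrestr (@lebesgue_measure R) (measurable_itv `[0%R, 1%R[).

HB.instance Definition _ (R : realType) := Measure.on (@unit_lebesgue R).

Lemma unit_lebesgue_setT (R : realType) : @unit_lebesgue R setT = 1%E.
Proof.
by rewrite /unit_lebesgue /mrestr setTI lebesgue_measure_itv /= lte01 sube0.
Qed.

HB.instance Definition _ (R : realType) :=
  @Measure_isProbability.Build _ _ R (@unit_lebesgue R) (@unit_lebesgue_setT R).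

Section kolmogorov_extension.
Context {R : realType} {k : nat}.
Local Notation Omega := (Omega R k).
Implicit Types (x y : Omega) (n : nat) (u : R).

Definition set_at n (a : 'I_k.+1) x : Omega := fun i => if i == n then a else x i.

(** [p n x] is the prescribed mass of the cylinder of length n around x. A function of points avoids
    conversions between words of different lengths. *)
Variable p : nat -> Omega -> R.
Hypothesis p_agree : forall n x y, agree n x y -> p n x = p n y.
Hypothesis p_ge0 : forall n x, 0 <= p n x.
Hypothesis p_0 : forall x, p 0 x = 1.
Hypothesis p_S : forall n x, p n x = \sum_a p n.+1 (set_at n a x).

(* [0, 1[ is cut into intervals of lengths [p 1 x], each of these into intervals
   of lengths [p 2 x], and so on; the address of a point drawn from Lebesgue
   measure has the required law. *)
Let c n x (j : nat) : R := \sum_(a < k.+1 | (a < j)%N) p n.+1 (set_at n a x).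

Let lo n x : R := \sum_(m < n) c m x (x m).

(** Half-open intervals, so that those of one generation are disjoint and fill [0, 1[; cylinders of
    mass 0 get empty ones. *)
Let inJ n x u : bool := lo n x <= u < lo n x + p n x.

Let set_at_id n x : set_at n (x n) x = x.
Proof. by apply/funext => i; rewrite /set_at; case: eqP => // ->. Qed.

Let agree_set_at n a x : agree n (set_at n a x) x.
Proof. by move=> i ni; rewrite /set_at ltn_eqF. Qed.

Let set_at_agree n a x y : agree n x y -> agree n.+1 (set_at n a x) (set_at n a y).
Proof.
move=> xy i; rewrite ltnS leq_eqVlt /set_at => /predU1P[->|ni]; first by rewrite eqxx.
by rewrite ltn_eqF// xy.
Qed.

Let c0 n x : c n x 0 = 0. Proof. by rewrite /c big_pred0. Qed.

Let c_last n x : c n x k.+1 = p n x.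
Proof. by rewrite p_S /c; apply: eq_bigl => a; rewrite ltn_ord. Qed.

Let cS n x (a : 'I_k.+1) : c n x a.+1 = c n x a + p n.+1 (set_at n a x).
Proof.
rewrite /c (bigD1 a)//= addrC; congr (_ + _); apply: eq_bigl => b.
by rewrite ltnS ltn_neqAle andbC.
Qed.

Let c_mono n x i j : (i <= j)%N -> c n x i <= c n x j.
Proof.
move=> ij; rewrite /c [leRHS](bigID (fun a : 'I__ => (a < i)%N))/=.
rewrite [X in _ <= X + _](eq_bigl (fun a : 'I_k.+1 => (a < i)%N)).
  by rewrite lerDl sumr_ge0.
by move=> a /=; case: (ltnP a i) => [/leq_trans -> //|]; rewrite andbF.
Qed.

Let c_agree n x y : agree n x y -> c n x =1 c n y.
Proof.
by move=> xy j; apply: eq_bigr => a _; apply: p_agree; exact: set_at_agree.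
Qed.

Let lo_agree n x y : agree n x y -> lo n x = lo n y.
Proof.
move=> xy; apply: eq_bigr => m _; rewrite xy//; apply: c_agree.
by apply: agreeS xy; exact: ltnW.
Qed.

Let inJ_agree n x y u : agree n x y -> inJ n x u = inJ n y u.
Proof. by move=> xy; rewrite /inJ (lo_agree xy) (p_agree xy). Qed.

Let inJ_S n x u : inJ n.+1 x u =
  (lo n x + c n x (x n) <= u < lo n x + c n x (x n).+1).
Proof.
by rewrite /inJ /lo big_ord_recr/= -/(lo n x) cS set_at_id addrA.
Qed.

Let inJ_nested n x u : inJ n.+1 x u -> inJ n x u.
Proof.
rewrite inJ_S => /andP[h1 h2]; apply/andP; split.
  by apply: le_trans h1; rewrite lerDl -(c0 n x) c_mono.
by apply: (lt_le_trans h2); rewrite lerD2l -c_last c_mono.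
Qed.

Let inJ_ex n x u : inJ n x u -> exists a, inJ n.+1 (set_at n a x) u.
Proof.
move=> /andP[h1 h2].
(* The next letter is j - 1 for the least such j. *)
have ex : exists j, u < lo n x + c n x j by exists k.+1; rewrite c_last.
have [j uj jmin] := ex_minnP ex.
have j0 : (0 < j)%N.
  by rewrite lt0n; apply/eqP => j0; move: uj; rewrite j0 c0 addr0 ltNge h1.
have jk : (j.-1 < k.+1)%N by rewrite prednK// jmin// c_last.
exists (Ordinal jk); have xx := agree_set_at (Ordinal jk) x.
rewrite inJ_S (lo_agree (@xx n)) !(c_agree (@xx n)) /set_at eqxx /= prednK// uj andbT.
by rewrite leNgt; apply/negP => /jmin; rewrite -ltnS prednK// ltnn.
Qed.

Let inJ_inj n x y u : inJ n x u -> inJ n y u -> agree n x y.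
Proof.
elim: n => [//|n IH] xu yu i.
have xy := IH (inJ_nested xu) (inJ_nested yu).
rewrite ltnS leq_eqVlt => /predU1P[->|]; last exact: xy.
move: xu yu; rewrite !inJ_S (lo_agree xy) !(c_agree xy).
move=> /andP[x1 x2] /andP[y1 y2]; apply/val_inj => /=.
have [xn|yn|//] := ltngtP (x n) (y n).
  have := le_lt_trans y1 x2; rewrite ltrD2l ltNge => /negP; case.
  exact: c_mono.
have := le_lt_trans x1 y2; rewrite ltrD2l ltNge => /negP; case.
exact: c_mono.
Qed.

Let inJ0 n x u : inJ n x u -> 0 <= u < 1.
Proof.
elim: n => [|n IH]; last by move/inJ_nested.
by rewrite /inJ /lo big_ord0 p_0 add0r.
Qed.

Fixpoint digits u n : Omega :=
  if n is m.+1 then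
    set_at m (odflt ord0 [pick a | inJ m.+1 (set_at m a (digits u m)) u]) (digits u m)
  else fun=> ord0.

Let expansion u : Omega := fun i => digits u i.+1 i.

Let digits_agree u n m : (n <= m)%N -> agree n (digits u m) (digits u n).
Proof.
move=> nm; elim: m nm => [|m IH]; first by rewrite leqn0 => /eqP -> i.
rewrite leq_eqVlt => /predU1P[-> //|]; rewrite ltnS => nm i ni /=.
by rewrite agree_set_at ?IH// (leq_trans ni).
Qed.

Let expansion_digits u n : agree n (expansion u) (digits u n).
Proof. by move=> i ni; rewrite /expansion (digits_agree u ni). Qed.

Let inJ_digits u n : 0 <= u < 1 -> inJ n (digits u n) u.
Proof.
move=> u01; elim: n => [|n IH]; first by rewrite /inJ /lo big_ord0 p_0 add0r.
have [a Ja] := inJ_ex IH.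
by rewrite /=; case: pickP => [//|/(_ a)]; rewrite Ja.
Qed.

Let digits_out u n : ~~ (0 <= u < 1) -> digits u n = fun=> ord0.
Proof.
move=> u01; elim: n => [//|n IH] /=; case: pickP => [a /inJ0 h|_] /=.
  by rewrite h in u01.
by rewrite IH; apply/funext => i; rewrite /set_at; case: eqP.
Qed.

Let inJ_expansion u n x : inJ n x u -> agree n (expansion u) x.
Proof.
move=> Ju; apply: (@inJ_inj n _ _ u) => //.
rewrite (inJ_agree _ (@expansion_digits u n)); apply: inJ_digits.
exact: inJ0 Ju.
Qed.

Let inJ_itv n x : [set u | inJ n x u] = [set` `[lo n x, lo n x + p n x[%R].
Proof. by apply/seteqP; split => u /=; rewrite in_itv. Qed.

(** Reals outside [0, 1[ all receive the address 000... They are null for [unit_lebesgue], but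
    measurability of the address map has to account for them. *)
Let expansion_fiber n (w : word k n) :
  (fun u => word_of n (expansion u)) @^-1` [set w] =
  [set u | inJ n (pt w) u] `|`
  [set u | ~~ (0 <= u < 1) /\ word_of n ((fun=> ord0) : Omega) = w].
Proof.
apply/seteqP; split => u /=.
  have [u01|u01] := boolP (0 <= u < 1) => uw.
    left; have := inJ_digits n u01; rewrite (inJ_agree (y := pt w))// => i ni.
    by rewrite -(@expansion_digits u n)// -uw agree_pt.
  right; split=> //; rewrite -uw; apply/agree_word_of => i ni.
  by rewrite (@expansion_digits u n)// digits_out.
case=> [Ju|[u01 <-]].
  by rewrite -[RHS](word_ofK (R := R)); apply/agree_word_of; exact: inJ_expansion.
by apply/agree_word_of => i ni; rewrite (@expansion_digits u n)// digits_out.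
Qed.

Let measurable_inJ n x : measurable ([set u | inJ n x u] : set (measurableTypeR R)).
Proof. by rewrite inJ_itv; exact: measurable_itv. Qed.

Lemma kolmogorov : exists rho : probability Omega R,
  forall n w, law rho (@word_of R k n) w = p n (pt w).
Proof.
have mD : measurable ([set u | ~~ (0 <= u < 1)] : set (measurableTypeR R)).
  rewrite (_ : mkset _ = ~` [set` `[0, 1[%R]); last first.
    by apply/seteqP; split => u /=; rewrite in_itv /= => /negP.
  by apply: measurableC; exact: measurable_itv.
have me : @measurable_fun _ _ (measurableTypeR R) Omega setT expansion.
  apply: measurable_fun_Omega => n w; rewrite expansion_fiber.
  apply: measurableU; first exact: measurable_inJ.
  have [e|ne] := eqVneq (word_of n ((fun=> ord0) : Omega)) w.
    rewrite (_ : mkset _ = [set u | ~~ (0 <= u < 1)])//.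
    by apply/seteqP; split => u /=; [case|].
  rewrite (_ : mkset _ = set0)// -subset0 => u /= [_ /eqP].
  by rewrite (negPf ne).
have [rho rhoE] := pushforward_probability (@unit_lebesgue R) me.
exists rho => n w; rewrite /law rhoE /=.
have -> : expansion @^-1` (@word_of R k n @^-1` [set w]) =
  (fun u => word_of n (expansion u)) @^-1` [set w] by [].
rewrite expansion_fiber /unit_lebesgue /mrestr.
set B := _ `|` _; have -> : B `&` [set` `[0%R, 1%R[] = [set u | inJ n (pt w) u].
  apply/seteqP; split => u.
    by rewrite /B /= in_itv /= => -[[|[/negPf ->]]].
  by move=> Ju; split; [left|rewrite /= in_itv /=; exact: inJ0 Ju].
rewrite inJ_itv lebesgue_measure_itv /= lte_fin ltrDl.
case: ltP => [_|p0]; first by rewrite -EFinB addrAC subrr add0r.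
by apply/eqP; rewrite eq_le p0 p_ge0.
Qed.

End kolmogorov_extension.

(** * Subadditivity and Bernoulli measures *)

Section subadditive_sequences.
Context {R : realType}.

(** Fekete's lemma: write N = q n + r with n nearly optimal; the remainder contributes at most M /
    N. Convergence matters because [partition_entropy] is a [limn], which says nothing about a
    divergent sequence. *)
Lemma fekete_cvg (H : nat -> R) : (forall n, 0 <= H n) ->
  (forall n m, H (n + m)%N <= H n + H m) -> cvgn (fun n => H n / n%:R).
Proof.
move=> H0 HD; pose F n := H n / n%:R.
have F0 n : 0 <= F n by rewrite divr_ge0.
pose S := [set F n | n in [set n | (0 < n)%N]].
have S_inf : has_inf S.
  by split; [exists (F 1%N), 1%N|exists 0 => _ [n _ <-]].
apply/cvg_ex; exists (inf S); apply/cvgrPdist_lt => e e0.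
have e20 : 0 < e / 2 by rewrite divr_gt0.
have [_ [n /= n0 <-] Fn] := inf_adherent e20 S_inf.
pose M := \sum_(r < n) H r.
have HM r : (r < n)%N -> H r <= M.
  by move=> rn; rewrite /M (bigD1 (Ordinal rn))//= lerDl sumr_ge0.
have Hq q r : H (q * n + r)%N <= q%:R * H n + H r.
  elim: q => [|q IH]; first by rewrite mul0n mul0r !add0r add0n.
  by rewrite mulSn -addnA (le_trans (HD _ _))// -natr1 mulrDl mul1r addrAC addrC lerD2l.
have n0' : 0 < n%:R :> R by rewrite ltr0n.
exists (Num.bound (M / (e / 2))).+1 => // N /= NM.
have N0 : (0 < N)%N by apply: leq_trans NM.
have N0' : 0 < N%:R :> R by rewrite ltr0n.
have lower : inf S <= F N by apply: inf_lbound; [case: S_inf|exists N].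
rewrite distrC ger0_norm ?subr_ge0// ltrBlDl -/(F N).
have : F N <= F n + e / 2; last by lra.
rewrite /F ler_pdivrMr// {1}(divn_eq N n) (le_trans (Hq _ _))// mulrDl lerD//.
  rewrite mulrAC ler_pdivlMr// mulrAC mulrC ler_wpM2l// -natrM ler_nat.
  exact: leq_divM.
apply: (le_trans (HM _ (ltn_pmod _ n0))); rewrite mulrC -ler_pdivrMr//.
have M0 : 0 <= M by rewrite sumr_ge0.
apply: (le_trans (ltW (archi_boundP (divr_ge0 M0 (ltW e20))))).
by rewrite ler_nat ltnW.
Qed.

End subadditive_sequences.

Section entropy_lower_bound.
Context {R : realType} {k : nat}.
Local Notation Omega := (Omega R k).
Variable mu : probability Omega R.
Hypothesis mu_inv : invariant_measure left_shift mu.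

(** The joins of the partition by the letter at index 0 are the cylinders. *)
Lemma entropy_ge (a : R) : (forall n, (0 < n)%N -> a <= block_entropy mu n / n%:R) ->
  (a%:E <= entropy left_shift mu)%E.
Proof.
move=> Ha; pose Pt (i : 'I_k.+1) : set Omega := [set x | x 0%N = i].
have mP : measurable_partition Pt.
  split.
  - move=> i; apply: measurable_open; apply/open_agreeP => x <-.
    by exists 1%N => y /(_ 0%N) ->.
  - by move=> i j _ _ [x [<- <-]].
  - by apply/seteqP; split => // x _; exists (x 0%N).
have joinE n : join_entropy left_shift mu Pt n = block_entropy mu n.
  rewrite /join_entropy /block_entropy /shannon; congr (- _).
  apply: eq_bigr => w _; rewrite /law (_ : join_cell _ _ _ = word_of n @^-1` [set w])//.
  apply/seteqP; split => x /=.
    move=> h; apply/ffunP => j; have := h j I.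
    by rewrite /Pt /= iter_left_shift /shiftn addn0 ffunE.
  by move=> <- j _; rewrite /Pt /= iter_left_shift /shiftn addn0 ffunE.
apply: (@le_trans _ _ (partition_entropy left_shift mu Pt)%:E); last first.
  by apply: ereal_sup_ubound; exists k.+1, Pt.
rewrite lee_fin /partition_entropy.
under eq_fun do rewrite joinE.
apply: limr_ge.
  apply: fekete_cvg => [n|n m]; first exact: block_entropy_ge0.
  exact: block_entropyD.
by exists 1%N => // n /=; exact: Ha.
Qed.

End entropy_lower_bound.

Section block_measure.
Context {R : realType} {k : nat}.
Local Notation Omega := (Omega R k).

Section iid.
Variable (K : nat) (pi : 'I_K.+1 -> R).
Hypothesis pi0 : forall a, 0 <= pi a.
Hypothesis pi1 : \sum_a pi a = 1.

Lemma bernoulli_measure : exists P : probability (Defs.Omega R K) R,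
  invariant_measure left_shift P /\
  forall n w, law P (@word_of R K n) w = \prod_i pi (w i).
Proof.
have [|||| P PE] := @kolmogorov R K (fun n x => \prod_(i < n) pi (x i)).
- by move=> n x y xy; apply: eq_bigr => i _; rewrite xy.
- by move=> n x; apply: prodr_ge0.
- by move=> x; rewrite big_ord0.
- move=> n x; under [RHS]eq_bigr => a _.
    rewrite big_ord_recr /= {2}/set_at eqxx.
    under eq_bigr => i _ do rewrite /set_at ltn_eqF//.
    over.
  by rewrite -mulr_sumr pi1 mulr1.
have lawE n w : law P (@word_of R K n) w = \prod_i pi (w i).
  by rewrite PE; apply: eq_bigr => i _; rewrite ptE.
exists P; split=> //; apply: invariant_measureP => n w.
pose tl (v : word K n.+1) : word K n := [ffun i : 'I_n => v (lift ord0 i)].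
have tlE : @word_of R K n \o left_shift = tl \o @word_of R K n.+1.
  by apply/funext => x; apply/ffunP => i; rewrite /= !ffunE.
rewrite tlE law_comp; last exact: measurable_word_of.
rewrite /push; under eq_bigr do rewrite lawE.
rewrite lawE.
(* The factor at index 0 is free and the one at index j + 1 forces the letter [w j]; summing out the
   free letter gives invariance. *)
pose G (i : 'I_n.+1) (a : 'I_K.+1) : R :=
  if unlift ord0 i is Some j then (if a == w j then pi a else 0) else pi a.
transitivity (\prod_i \sum_a G i a).
  rewrite bigA_distr_bigA /= big_mkcond; apply: eq_bigr => v _.
  rewrite !big_ord_recl /= [G ord0 _]/G unlift_none.
  case: (eqVneq (tl v) w) => [e|ne].
    by congr (_ * _); apply: eq_bigr => i _; rewrite /G liftK -e ffunE eqxx.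
  have [i vi] : exists i, v (lift ord0 i) != w i.
    apply/existsP; apply: contraNT ne => /existsPn h; apply/eqP/ffunP => i.
    by rewrite ffunE; apply/eqP/negPn/h.
  by rewrite (bigD1 i)//= [G (lift _ _) _]/G liftK (negPf vi) mul0r mulr0.
rewrite big_ord_recl (eq_bigr pi) /= ?pi1 ?mul1r; last first.
  by move=> a _; rewrite /G unlift_none.
apply: eq_bigr => i _; rewrite /G liftK -big_mkcond big_pred1_eq//.
Qed.

End iid.
End block_measure.

(** * Block-Bernoulli measures *)

Section block_measure.
Context {R : realType} {k K l' : nat}.
Local Notation Omega := (Omega R k).
Local Notation l := l'.+1.
Variables (pi : 'I_K.+1 -> R) (dec : 'I_K.+1 -> word k l) (enc : word k l -> 'I_K.+1).
Hypothesis decK : cancel dec enc.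
Hypothesis pi0 : forall a, 0 < pi a.
Hypothesis pi1 : \sum_a pi a = 1.
Variable P : probability (Defs.Omega R K) R.
Hypothesis P_inv : invariant_measure left_shift P.
Hypothesis lawP : forall n w, law P (@word_of R K n) w = \prod_i pi (w i).

(** Words of length l are coded by ordinals so that the sequence of blocks is again a point of an
    [Omega] type, on which a Bernoulli measure is available. *)
Definition concat (x : Defs.Omega R K) : Omega :=
  fun q => pt (R := R) (dec (x (q %/ l)%N)) (q %% l)%N.

Lemma concat_shift x : concat (left_shift x) = shiftn l (concat x).
Proof.
apply/funext => q; rewrite /concat /shiftn /left_shift.
by rewrite -[in (l + q)%N](mul1n l) divnMDl// modnMDl add1n.
Qed.

Lemma agree_concat N x y : agree N x y -> agree N (concat x) (concat y).
Proof.
by move=> xy q qN; rewrite /concat xy// (leq_ltn_trans (leq_div _ _)).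
Qed.

Lemma shift_concatE (x : Defs.Omega R K) j :
  agree l (shiftn (j * l) (concat x)) (pt (dec (x j))).
Proof.
by move=> q ql; rewrite /shiftn /concat divnMDl// divn_small// addn0 modnMDl modn_small.
Qed.

Definition window i n (x : Defs.Omega R K) : word k n := word_of n (shiftn i (concat x)).

Lemma window_agree i n x y : agree (i + n) x y -> window i n x = window i n y.
Proof. by move=> xy; apply/agree_word_of/agree_shiftn/agree_concat. Qed.

Lemma windowE i n N : (i + n <= N)%N ->
  window i n = (window i n \o @pt R K N) \o @word_of R K N.
Proof.
move=> iN; apply/funext => x /=; apply: window_agree => q qi.
by rewrite agree_pt// (leq_trans qi).
Qed.

Lemma measurable_window i n : measurable_fibers (window i n).
Proof.
by rewrite (windowE (leqnn _)); apply: measurable_fibers_comp; exact: measurable_word_of.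
Qed.

(* The law of the concatenation is only invariant under [shiftn l]; averaging
   over the [l] possible starting points makes it shift invariant. *)
Definition window_avg n (w : word k n) : R :=
  l%:R^-1 * \sum_(i < l) law P (window i n) w.

Lemma sum_extensions n (x : Omega) (F : word k n.+1 -> R) :
  \sum_(v | word_of n (pt (R := R) v) == word_of n x) F v =
  \sum_a F (word_of n.+1 (set_at n a x)).
Proof.
rewrite (reindex_onto (fun a => word_of n.+1 (set_at n a x))
  (fun v : word k n.+1 => v ord_max)) /=.
  apply: eq_bigl => a; rewrite ffunE /set_at eqxx eqxx andbT.
  apply/eqP/agree_word_of => i ni.
  by rewrite agree_pt ?ltnS 1?ltnW// ltn_eqF.
move=> v /eqP /agree_word_of vx; apply/ffunP => i; rewrite ffunE /set_at.
case: eqP => [e|/eqP ne]; first by congr (v _); apply/val_inj.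
by rewrite -vx ?ptE// ltn_neqAle ne -ltnS ltn_ord.
Qed.

Lemma averaged_measure : exists rho : probability Omega R,
  forall n, law rho (@word_of R k n) =1 @window_avg n.
Proof.
have wavg0 n w : 0 <= @window_avg n w.
  by rewrite mulr_ge0 ?invr_ge0// sumr_ge0// => i _; exact: law_ge0.
have [|||| rho rhoE] := @kolmogorov R k (fun n x => @window_avg n (word_of n x)).
- by move=> n x y /agree_word_of ->.
- by [].
- move=> x; rewrite /window_avg (eq_bigr (fun=> 1)) => [|i _].
    by rewrite sumr_const card_ord mulVf ?pnatr_eq0.
  rewrite -(law_sum P (@measurable_window i 0)) [RHS](bigD1 (word_of 0 x))//=.
  by rewrite big1 ?addr0// => w' /eqP; case; apply/ffunP => -[].
- move=> n x; rewrite /window_avg -mulr_sumr exchange_big /=; congr (_ * _).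
  apply: eq_bigr => i _; rewrite -(sum_extensions x (law P (window i n.+1))).
  rewrite -/(push (fun v => word_of n (pt (R := R) v)) (law P (window i n.+1)) (word_of n x)).
  rewrite -law_comp; last exact: measurable_window.
  congr (law P _ _); apply/funext => y /=; apply/agree_word_of => q qn.
  by rewrite agree_pt// ltnW.
by exists rho => n w; rewrite rhoE word_ofK.
Qed.

Section properties.
Variable rho : probability Omega R.
Hypothesis rhoE : forall n, law rho (@word_of R k n) =1 @window_avg n.

(** The shift replaces the starting point i by i + 1. The one new term, i = l, has the law of i = 0
    by invariance of P, since [concat] turns the shift into [shiftn l]. *)
Lemma averaged_invariant : invariant_measure left_shift rho.
Proof.
apply: invariant_measureP => n w.
pose tl (v : word k n.+1) : word k n := word_of n (left_shift (pt (R := R) v)).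
have tlE : @word_of R k n \o left_shift = tl \o @word_of R k n.+1.
  apply/funext => x; apply/agree_word_of => q qn /=.
  by rewrite /left_shift agree_pt.
rewrite tlE law_comp ?rhoE; last exact: measurable_word_of.
rewrite (eq_push (g' := tl) (p' := @window_avg n.+1))// /push /window_avg.
rewrite -mulr_sumr exchange_big /=; congr (_ * _).
have windowS i : \sum_(v | tl v == w) law P (window i n.+1) v = law P (window i.+1 n) w.
  rewrite -/(push tl (law P (window i n.+1)) w) -law_comp; last exact: measurable_window.
  congr (law P _ _); apply/funext => x /=; apply/agree_word_of => q qn.
  by rewrite /left_shift agree_pt// /shiftn addnS.
under eq_bigr do rewrite windowS.
rewrite big_ord_recr [RHS]big_ord_recl /= addrC; congr (_ + _).
rewrite (_ : window l n = window 0 n \o shiftn 1).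
  by rewrite law_shiftn//; exact: measurable_window.
apply/funext => x; rewrite /window /= -left_shiftE concat_shift.
by congr word_of; apply/funext => q; rewrite /shiftn.
Qed.

(** The window contains the r complete blocks numbered 1 to r, and decoding them recovers r
    independent letters of law pi. *)
Lemma window_entropy i n r : (i <= l)%N -> (r.+1 * l <= n)%N ->
  r%:R * shannon pi <= shannon (law P (window i n)).
Proof.
move=> il rn; rewrite -shannon_prod//.
pose g (w : word k n) : word K r :=
  [ffun j : 'I_r => enc (word_of l (shiftn (j.+1 * l - i) (pt (R := R) w)))].
have gE : g \o window i n = @word_of R K r \o shiftn 1.
  apply/funext => x; apply/ffunP => j; rewrite !ffunE /= -[RHS]decK; congr enc.
  rewrite -[RHS](word_ofK (R := R)); apply/agree_word_of => q ql.
  rewrite -(shift_concatE x j.+1 ql) /shiftn agree_pt.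
    by congr (concat x _); have := leq_pmull l (ltn0Sn j); lia.
  have : (j.+2 * l <= r.+1 * l)%N by rewrite leq_mul2r ltnS ltn_ord orbT.
  by rewrite !mulSn; move: il rn; rewrite !mulSn; lia.
rewrite (_ : shannon _ = shannon (push g (law P (window i n)))).
  by apply: shannon_push => a; exact: law_ge0.
apply: eq_shannon => w; rewrite -law_comp; last exact: measurable_window.
rewrite gE law_shiftn ?lawP//; exact: measurable_word_of.
Qed.

(** Concavity reduces the average to single windows; the loss of 2 covers the incomplete blocks at
    the two ends and the rounding of n / l. *)
Lemma averaged_block_entropy n : (n%:R / l%:R - 2) * shannon pi <= block_entropy rho n.
Proof.
have h0 : 0 <= shannon pi by apply: shannon_ge0 => // a; exact: ltW.
have -> : block_entropy rho n = shannon (@window_avg n) by apply: eq_shannon.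
have [ln|nl] := leqP l n; last first.
  rewrite (@le_trans _ _ 0)//.
    rewrite mulr_le0_ge0// subr_le0 ler_pdivrMr ?ltr0n//.
    by rewrite -natrM ler_nat; lia.
  apply: shannon_ge0 => [a|].
    by rewrite mulr_ge0 ?invr_ge0// sumr_ge0// => i _; exact: law_ge0.
  rewrite -(law_sum rho (@measurable_word_of R k n)).
  by apply: eq_bigr => w _; rewrite rhoE.
apply: (@le_trans _ _ (l%:R^-1 * \sum_(i < l) shannon (law P (window i n)))); last first.
  apply: shannon_avg => i.
    by move=> a; exact: law_ge0.
  by apply: law_sum; exact: measurable_window.
pose r := (n %/ l).-1.
have rl : r.+1 = (n %/ l)%N by rewrite prednK// divn_gt0.
apply: (@le_trans _ _ (l%:R^-1 * \sum_(i < l) r%:R * shannon pi)).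
  rewrite (_ : \sum_(i < l) r%:R * shannon pi = l%:R * (r%:R * shannon pi)).
    2: by rewrite sumr_const card_ord [RHS]mulr_natl.
  rewrite mulKf ?pnatr_eq0//.
  rewrite ler_wpM2r// lerBlDr ler_pdivrMr ?ltr0n//.
  rewrite (_ : r%:R + 2 = r.+2%:R); last by rewrite -[r.+2]addn2 natrD.
  rewrite -natrM ler_nat rl {1}(divn_eq n l) mulSn addnC leq_add2r.
  by rewrite ltnW// ltn_pmod.
rewrite ler_wpM2l ?invr_ge0//; apply: ler_sum => i _.
apply: window_entropy; first exact: ltnW.
by rewrite rl leq_divM.
Qed.

(** [entropy_ge] wants a bound for each n without the loss of 2. Using length q n and
    [block_entropyM], that loss is divided by q, which is arbitrary. *)
Lemma averaged_entropy : ((shannon pi / l%:R)%:E <= entropy left_shift rho)%E.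
Proof.
have h0 : 0 <= shannon pi by apply: shannon_ge0 => // a; exact: ltW.
apply: (entropy_ge averaged_invariant) => n n0.
have n0' : 0 < n%:R :> R by rewrite ltr0n.
rewrite ler_pdivlMr//; set b := block_entropy rho n.
rewrite leNgt; apply/negP => lt.
pose d := shannon pi / l%:R * n%:R - b; have d0 : 0 < d by rewrite subr_gt0.
have := archi_boundP (divr_ge0 (mulr_ge0 (ler0n R 2) h0) (ltW d0)).
move: (Num.bound _) => q; rewrite ltr_pdivrMr// ltNge => /negP; apply.
have := le_trans (averaged_block_entropy (q * n)) (block_entropyM averaged_invariant n q).
rewrite -/b natrM /d.
have -> : (q%:R * n%:R / l%:R - 2) * shannon pi =
  q%:R * (shannon pi / l%:R * n%:R) - 2 * shannon pi by ring.
by rewrite [q%:R * (_ - b)]mulrBr !lerBlDr addrC.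
Qed.

(** One E for replacing A by its values on l-cylinders, one for truncating the windows to length l,
    one for the continuation after the first block. *)
Lemma averaged_mean (A : Omega -> R) (C z : R) :
  regular A C z -> 0 <= C -> 0 < z < 1 ->
  `|l%:R * mean rho A - \sum_a pi a * birkhoff A l (pt (dec a))| <= 3 * (C / (1 - z)).
Proof.
move=> AC C0 z01; have /andP[z0 z1] := z01; set E := C / (1 - z).
(* l z^l is at most the sum of z^j over j < l, as each of these terms is at least z^l. *)
have lz : l%:R * (C * z ^+ l) <= E.
  rewrite mulrCA ler_wpM2l// (le_trans _ (geo_sum_le l _)) ?(ltW z0)//.
  rewrite mulr_natl -[l in _ *+ l]card_ord -sumr_const; apply: ler_sum => j _.
  by rewrite ler_wiXn2l ?(ltW z0) ?(ltW z1)// ltnW.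
have mA := measurable_regular z01 AC.
have [_ h1] := @Rintegral_approx _ _ _ rho _ _ (@measurable_word_of R k l)
  A (fun w => A (pt w)) (C * z ^+ l) mA
  (fun x => AC _ _ _ (fun i il => esym (@agree_pt R k l x i il))).
pose N := (l + l)%N; pose L := law P (@word_of R K N).
have L1 : \sum_v L v = 1 by apply: law_sum; exact: measurable_word_of.
have L0 v : 0 <= L v by exact: law_ge0.
have sumL (v : word K N -> R) (e : R) : (forall w, `|v w| <= e) ->
    `|\sum_w L w * v w| <= e.
  move=> ve; rewrite (le_trans (ler_norm_sum _ _ _))//.
  rewrite -[e]mul1r -L1 mulr_suml; apply: ler_sum => w _.
  by rewrite normrM ger0_norm// ler_wpM2l.
have e1 : l%:R * (\sum_w law rho (@word_of R k l) w * A (pt w)) =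
    \sum_v L v * \sum_(i < l) A (pt (window i l (pt (R := R) v))).
  under eq_bigr do rewrite rhoE /window_avg -mulrA.
  rewrite -mulr_sumr mulrA mulfV ?pnatr_eq0// mul1r.
  under eq_bigr do rewrite mulr_suml.
  under [RHS]eq_bigr do rewrite mulr_sumr.
  rewrite exchange_big [RHS]exchange_big /=; apply: eq_bigr => i _.
  rewrite -(sum_push (window i l \o @pt R K N) L (fun w => A (pt w))).
  apply: eq_bigr => w _; congr (_ * _).
  rewrite -law_comp -?windowE//; last exact: measurable_word_of.
  by rewrite leq_add2r ltnW.
have e2 : \sum_a pi a * birkhoff A l (pt (dec a)) =
    \sum_v L v * birkhoff A l (pt (dec (v ord0))).
  rewrite -(@prod_marginal R _ N pi (fun a => birkhoff A l (pt (dec a))) ord0 pi1).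
  by apply: eq_bigr => v _; rewrite /L lawP.
have h2 : `|l%:R * (\sum_w law rho (@word_of R k l) w * A (pt w)) -
    \sum_a pi a * birkhoff A l (pt (dec a))| <= E + E.
  rewrite e1 e2 -sumrB; under eq_bigr do rewrite -mulrBr.
  apply: sumL => v; pose y := concat (pt v).
  have -> : \sum_(i < l) A (pt (window i l (pt v))) - birkhoff A l (pt (dec (v ord0))) =
    (\sum_(i < l) (A (pt (window i l (pt v))) - A (shiftn i y))) +
    (birkhoff A l y - birkhoff A l (pt (dec (v ord0)))).
    by rewrite sumrB /birkhoff addrA subrK.
  rewrite (le_trans (ler_normD _ _))// lerD//.
    rewrite (le_trans (ler_norm_sum _ _ _))// (le_trans _ lz)//.
    rewrite mulr_natl -[l in _ *+ l]card_ord -sumr_const; apply: ler_sum => i _.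
    by apply: AC; exact: agree_pt.
  apply: (birkhoff_agree_self AC C0 z01).
  by have := @shift_concatE (pt v) 0; rewrite mul0n (ptE v ord0).
have h1' : `|l%:R * mean rho A - l%:R * (\sum_w law rho (@word_of R k l) w * A (pt w))| <= E.
  by rewrite -mulrBr normrM ger0_norm// (le_trans _ lz)// ler_wpM2l.
move: h1' h2; rewrite !ler_norml => /andP[? ?] /andP[? ?].
by apply/andP; split; lra.
Qed.

End properties.
End block_measure.

(** * Pressure and partition functions *)

Section variational_estimates.
Context {R : realType} {k : nat}.
Local Notation Omega := (Omega R k).
Variables (A : Omega -> R) (C z : R).
Hypothesis A_reg : regular A C z.
Hypothesis C0 : 0 <= C.
Hypothesis z01 : 0 < z < 1.

Let z0 : 0 < z. Proof. by case/andP: z01. Qed.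
Let z1 : z < 1. Proof. by case/andP: z01. Qed.
Let E := C / (1 - z).
Let E0 : 0 <= E. Proof. by rewrite divr_ge0 ?subr_ge0 ?(ltW z1). Qed.

Lemma integrable_regular (rho : probability Omega R) :
  rho.-integrable setT (EFin \o A).
Proof.
have [//] := @Rintegral_approx _ _ _ rho _ _ (@measurable_word_of R k 0)
  A (fun w => A (pt w)) (C * z ^+ 0) (measurable_regular z01 A_reg)
  (fun x => A_reg (fun i il => esym (@agree_pt R k 0 x i il))).
Qed.

Lemma mean_scale (rho : probability Omega R) (s : R) :
  mean rho (fun x => s * A x) = s * mean rho A.
Proof. by rewrite /mean RintegralZl//; exact: integrable_regular. Qed.

(** By invariance the j-th term can be computed at time 0 from words of length n - j. Two
    approximations of size C z^(n-j) are made, and their sum over j is bounded uniformly in n. *)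
Lemma mean_birkhoff (mu : probability Omega R) n :
  invariant_measure left_shift mu ->
  `|n%:R * mean mu A - \sum_w law mu (@word_of R k n) w * birkhoff A n (pt w)|
    <= 2 * E.
Proof.
move=> mu_inv.
have mw l := @measurable_word_of R k l.
have one (j : 'I_n) : `|mean mu A -
    \sum_w law mu (@word_of R k n) w * A (shiftn j (pt w))| <= 2 * (C * z ^+ (n - j)).
  have [_ h1] := @Rintegral_approx _ _ _ mu _ _ (mw (n - j)%N)
    A (fun w => A (pt w)) (C * z ^+ (n - j)) (measurable_regular z01 A_reg)
    (fun x => A_reg (fun i il => esym (@agree_pt R k (n - j) x i il))).
  pose g (v : word k n) := @word_of R k (n - j) (shiftn j (pt v)).
  have h2 : \sum_w law mu (@word_of R k (n - j)) w * A (pt w) =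
      \sum_v law mu (@word_of R k n) v * A (pt (g v)).
    rewrite -(sum_push g _ (fun w => A (pt w))); apply: eq_bigr => w _.
    congr (_ * _); rewrite -law_comp// -(law_shiftn mu_inv j (mw (n - j)%N)).
    congr (law mu _ _); apply/funext => x /=; apply/agree_word_of.
    apply: agree_shiftn => i ij; rewrite agree_pt//.
    by apply: (leq_trans ij); rewrite subnKC// ltnW.
  have h3 : `|\sum_v law mu (@word_of R k n) v * A (pt (g v)) -
      \sum_w law mu (@word_of R k n) w * A (shiftn j (pt w))| <= C * z ^+ (n - j).
    rewrite -sumrB (le_trans (ler_norm_sum _ _ _))//.
    rewrite -[leRHS]mul1r -(law_sum mu (mw n)) mulr_suml.
    apply: ler_sum => w _; rewrite -mulrBr normrM ger0_norm ?law_ge0//.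
    by rewrite ler_wpM2l ?law_ge0//; apply: A_reg; exact: agree_pt.
  move: h1 h3; rewrite h2 /mean !ler_norml => /andP[? ?] /andP[? ?].
  by apply/andP; split; lra.
have -> : n%:R * mean mu A = \sum_(j < n) mean mu A.
  by rewrite sumr_const card_ord mulr_natl.
have -> : \sum_w law mu (@word_of R k n) w * birkhoff A n (pt w) =
    \sum_(j < n) \sum_w law mu (@word_of R k n) w * A (shiftn j (pt w)).
  by rewrite exchange_big; apply: eq_bigr => w _; rewrite mulr_sumr.
rewrite -sumrB (le_trans (ler_norm_sum _ _ _))//.
apply: (@le_trans _ _ (\sum_(j < n) 2 * (C * z ^+ (n - j)))); first exact: ler_sum.
rewrite -mulr_sumr ler_wpM2l// -mulr_sumr ler_wpM2l//.
have := @geo_sum_rev_le R z n n; rewrite subnn expr0 mul1r; apply => //.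
by rewrite ltW.
Qed.

Lemma entropy_fin (mu : probability Omega R) : invariant_measure left_shift mu ->
  entropy left_shift mu \is a fin_num.
Proof.
move=> mu_inv; rewrite fin_real//; apply/andP; split.
  apply: (@lt_le_trans _ _ 0%E) => //; apply: (entropy_ge mu_inv) => n n0.
  by rewrite divr_ge0// block_entropy_ge0.
by apply: (le_lt_trans (entropy_le mu_inv (ltn0Sn 0))); rewrite ltry.
Qed.

(** The block-Bernoulli measure with Gibbs weights on the words of length n is a competitor in the
    supremum. Its entropy and mean reproduce ln Z_n / n up to the distortion in [averaged_mean]. *)
Lemma partition_function_le (s c : R) :
  (forall rho : probability Omega R, invariant_measure left_shift rho ->
    ((s * mean rho A)%:E + entropy left_shift rho <= c%:E)%E) ->
  forall n, partition_function A n s <= expR (n%:R * c + `|s| * (3 * E)).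
Proof.
move=> opt [|l'].
  rewrite mul0r add0r /partition_function (eq_bigr (fun=> 1)) => [|w _].
    rewrite sumr_const card_ffun !card_ord expn0 -[leLHS]expR0 ler_expR.
    by rewrite mulr_ge0//; apply: mulr_ge0.
  by rewrite /birkhoff big_ord0 mulr0 expR0.
set l := l'.+1; pose F := word k l.
have F0 : (0 < #|F|)%N by apply/card_gt0P; exists [ffun=> ord0].
have FK : #|F|.-1.+1 = #|F| by rewrite prednK.
pose dec (a : 'I_#|F|.-1.+1) : F := enum_val (cast_ord FK a).
pose enc (w : F) : 'I_#|F|.-1.+1 := cast_ord (esym FK) (enum_rank w).
have decK : cancel dec enc by move=> a; rewrite /enc /dec enum_valK cast_ordK.
have encK : cancel enc dec by move=> w; rewrite /enc /dec cast_ordKV enum_rankK.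
have sum_dec (v : F -> R) : \sum_a v (dec a) = \sum_w v w.
  by rewrite [RHS](reindex dec)//; exists enc => a _; [exact: decK|exact: encK].
pose S (w : F) := s * birkhoff A l (pt w).
have [Z0 g0 g1 gE] := gibbs_distP S [ffun=> ord0].
pose pi a := gibbs_dist S (dec a).
have pi1 : \sum_a pi a = 1 by rewrite (sum_dec (gibbs_dist S)).
have [P [P_inv lawP]] := bernoulli_measure (fun a => ltW (g0 (dec a))) pi1.
have [rho rhoE] := averaged_measure dec P.
have rho_inv := averaged_invariant P_inv rhoE.
have ent := averaged_entropy decK (fun a => g0 (dec a)) pi1 P_inv lawP rhoE.
have mn := averaged_mean pi1 lawP rhoE A_reg C0 z01.
have shE : shannon pi = shannon (gibbs_dist S).
  by rewrite /shannon (sum_dec (fun w => gibbs_dist S w * ln (gibbs_dist S w))).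
have smE : \sum_a pi a * birkhoff A l (pt (dec a)) =
    \sum_w gibbs_dist S w * birkhoff A l (pt w).
  exact: (sum_dec (fun w => gibbs_dist S w * birkhoff A l (pt w))).
have SE : \sum_w gibbs_dist S w * S w =
    s * \sum_w gibbs_dist S w * birkhoff A l (pt w).
  by rewrite mulr_sumr; apply: eq_bigr => w _; rewrite /S mulrCA.
have := le_trans (leeD2l (s * mean rho A)%:E ent) (opt rho rho_inv).
rewrite -EFinD lee_fin -[l'.+1]/l => hopt.
have l0 : 0 < l%:R :> R by rewrite ltr0n.
have hopt' : l%:R * (s * mean rho A) + shannon pi <= l%:R * c.
  have -> : shannon pi = l%:R * (shannon pi / l%:R) by rewrite mulrC divfK// gt_eqF.
  by rewrite -mulrDr ler_wpM2l// ltW.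
rewrite -[leLHS]lnK ?posrE// ler_expR -gE -shE SE -smE.
set X := \sum_a _.
have : s * X - s * (l%:R * mean rho A) <= `|s| * (3 * E).
  rewrite -mulrBr (le_trans (ler_norm _))// normrM ler_wpM2l// distrC.
  exact: mn.
have -> : s * (l%:R * mean rho A) = l%:R * (s * mean rho A) by rewrite mulrCA.
move: hopt'; set a := l%:R * (s * _); set b := l%:R * c; set e := `|s| * _.
by move: (shannon pi) (s * X) => h y; lra.
Qed.

(** The finite variational inequality is applied to the cylinder law of mu, with [entropy_le] used
    at this very n. *)
Lemma partition_function_ge (mu : probability Omega R) (s : R) :
  invariant_measure left_shift mu ->
  forall n, expR (n%:R * (s * mean mu A + fine (entropy left_shift mu)) -
    `|s| * (2 * E)) <= partition_function A n s.
Proof.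
move=> mu_inv n; have mw := @measurable_word_of R k n.
have Z0 : 0 < partition_function A n s.
  rewrite /partition_function (bigD1 [ffun=> ord0])//= ltr_pwDl ?expR_gt0//.
  by rewrite sumr_ge0// => *; exact: expR_ge0.
rewrite -[leRHS]lnK ?posrE// ler_expR.
have := @shannon_free_energy R _ (law mu (@word_of R k n))
  (fun w => s * birkhoff A n (pt w)) (@law_ge0 _ _ _ mu _ _) (law_sum mu mw).
apply: le_trans; rewrite -/(block_entropy mu n).
have hn : n%:R * fine (entropy left_shift mu) <= block_entropy mu n.
  have [->|n0] := posnP n; first by rewrite mul0r block_entropy_ge0.
  rewrite mulrC -ler_pdivlMr ?ltr0n// -lee_fin fineK ?entropy_fin//.
  exact: entropy_le.
have := mean_birkhoff n mu_inv; set X := \sum_w _ => hX.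
have -> : \sum_w law mu (@word_of R k n) w * (s * birkhoff A n (pt w)) = s * X.
  by rewrite mulr_sumr; apply: eq_bigr => w _; rewrite mulrCA.
have : s * (n%:R * mean mu A) - s * X <= `|s| * (2 * E).
  by rewrite -mulrBr (le_trans (ler_norm _))// normrM ler_wpM2l.
rewrite mulrDr [n%:R * (s * _)]mulrCA; move: hn.
move: (n%:R * fine _) (s * (n%:R * _)) (s * X) (block_entropy mu n) (`|s| * _).
by move=> a b c d e; lra.
Qed.

(** With s the midpoint and th half the difference, the main exponents at s1 and s2 add up to twice
    the one at s, so Z(s + th) Z(s - th) / Z(s)^2 is bounded in n. *)
Lemma common_equilibrium_livsic (mu : probability Omega R) (s1 s2 : R) :
  invariant_measure left_shift mu -> s1 != s2 ->
  (forall s, s \in [:: s1; s2] ->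
   forall rho : probability Omega R, invariant_measure left_shift rho ->
    ((s * mean rho A)%:E + entropy left_shift rho <=
     (s * mean mu A)%:E + entropy left_shift mu)%E) ->
  exists (c : R) (B : Omega -> R),
    regular B E z /\ forall x, A x = c + B (left_shift x) - B x.
Proof.
move=> mu_inv s12 opt; set m := mean mu A; set h := fine (entropy left_shift mu).
have optE s : s \in [:: s1; s2] -> forall n,
    partition_function A n s <= expR (n%:R * (s * m + h) + `|s| * (3 * E)).
  move=> ss; apply: partition_function_le => rho /(opt s ss).
  by rewrite /h EFinD fineK ?entropy_fin.
pose s := (s1 + s2) / 2; pose th := (s1 - s2) / 2.
have th0 : th != 0 by rewrite mulf_neq0 ?subr_eq0 ?invr_eq0.
(* The distortion errors of the two upper bounds and of the squared lower bound. *)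
pose e := `|s1| * (3 * E) + `|s2| * (3 * E) + 2 * (`|s| * (2 * E)).
have H n : partition_function A n (s + th) * partition_function A n (s - th) <=
    expR e * partition_function A n s ^+ 2.
  have -> : s + th = s1 by rewrite /s /th; field.
  have -> : s - th = s2 by rewrite /s /th; field.
  have p0 t : 0 <= partition_function A n t.
    by apply: sumr_ge0 => w _; exact: expR_ge0.
  apply: (le_trans (ler_pM (p0 _) (p0 _) (optE s1 _ n) (optE s2 _ n))).
  - by rewrite inE eqxx.
  - by rewrite !inE eqxx orbT.
  have ge := partition_function_ge s mu_inv n; rewrite -/m -/h in ge.
  apply: (@le_trans _ _ (expR e * expR (n%:R * (s * m + h) - `|s| * (2 * E)) ^+ 2)).
    by rewrite expr2 -!expRD ler_expR /e /s; lra.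
  by rewrite ler_wpM2l ?expR_ge0// ler_pXn2r ?nnegrE ?expR_ge0.
apply: (livsic A_reg C0 z01 (Q := 3 * E + 1)) => l u u'.
have [l0|l0] := posnP l.
  by subst l; rewrite /birkhoff !big_ord0 subrr addr_ge0//; apply: mulr_ge0.
exact: (bounded_osc_of_partition_function A_reg C0 z01 l0 u u' th0 H).
Qed.

End variational_estimates.

(** * Differentiability from a quadratic sandwich, and the theorem *)

Section quadratic_sandwich.
Context {R : realType}.

Lemma derive_quadratic_sandwich (f : R -> R) (t m L : R) :
  (forall s, L + m * (s - t) <= f s <= L + m * (s - t) + (s - t) ^+ 2 / 2) ->
  derivable f t 1 /\ f^`()%classic t = m.
Proof.
move=> H.
have ft : f t = L.
  have := H t; rewrite subrr mulr0 expr0n/= mul0r !addr0 => ?.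
  by apply/eqP; rewrite eq_le andbC.
have cv : h^-1 *: (f (h *: 1 + t) - f t) @[h --> 0^'] --> m.
  apply/cvgrPdist_le => e e0; near=> h.
  have h0 : h != 0 by near: h; exact: nbhs_dnbhs_neq.
  have he : `|h| <= e.
    by near: h; exact: dnbhs0_le.
  rewrite ft /GRing.scale /= mulr1.
  have := H (h + t); rewrite addrK => /andP[l1 l2].
  have -> : m - h^-1 * (f (h + t) - L) = h^-1 * (m * h - (f (h + t) - L)).
    by rewrite [RHS]mulrBr [h^-1 * (m * h)]mulrCA mulVf// mulr1.
  rewrite normrM normfV ler_pdivrMl ?normr_gt0//.
  apply: (@le_trans _ _ (h ^+ 2)).
    have := sqr_ge0 h; rewrite ler_norml => h2; apply/andP; split; lra.
  by rewrite -normr_id -real_normK ?num_real// normr_id expr2 ler_wpM2l.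
split; first by apply/cvg_ex; exists m.
by rewrite derive1E; apply: cvg_lim.
Unshelve. all: by end_near. Qed.

End quadratic_sandwich.

Theorem theorem2p5 (R : realType) (k : nat) (A : Omega R k -> R)
    (hA : hoelder_continuous A) (hAc : ~ cohomologous_to_constant A)
    (t : R) (mu_tA : probability (Omega R k) R)
    (hmu : linear_equilibrium (fun x => t * A x) mu_tA)
    (hmax : quadratic_value A mu_tA = quadratic_pressure A) :
  [/\ derivable (chat A) t 1,
      ((chat A)^`()%classic) t = \int[mu_tA]_x A x &
      \int[mu_tA]_x A x = t].
Proof.
have [C [theta [C0 t01 A_reg]]] := hoelder_regular hA.
have z01 : 0 < 2^-1 `^ theta < (1 : R) by apply: half_powR; case/andP: t01.
have [mu_inv lin] := hmu.
set m := \int[mu_tA]_x A x; pose h := fine (entropy left_shift mu_tA).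
have hE : entropy left_shift mu_tA = h%:E by rewrite fineK// entropy_fin.
have quad (rho : probability (Omega R k) R) : invariant_measure left_shift rho ->
    mean rho A ^+ 2 / 2 + fine (entropy left_shift rho) <= m ^+ 2 / 2 + h.
  move=> rho_inv; have : (quadratic_value A rho <= quadratic_value A mu_tA)%E.
    by rewrite hmax; apply: ereal_sup_ubound; exists rho.
  rewrite /quadratic_value hE -(fineK (entropy_fin rho_inv)).
  by rewrite -!EFinD lee_fin lerD2r.
have upper (s : R) (rho : probability (Omega R k) R) :
    invariant_measure left_shift rho ->
    ((s * mean rho A)%:E + entropy left_shift rho <=
     (m * s + h + (s - m) ^+ 2 / 2)%:E)%E.
  move=> rho_inv; rewrite -(fineK (entropy_fin rho_inv)) -EFinD lee_fin.
  have := quad rho rho_inv; have := sqr_ge0 (s - mean rho A).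
  by rewrite !sqrrB; nra.
have tm : m = t.
  apply/eqP/negPn/negP => mt; apply: hAc.
  have [|c [B [B_reg BE]]] := common_equilibrium_livsic A_reg C0 z01 mu_inv mt.
    move=> s; rewrite !inE => /orP[/eqP ->|/eqP ->] rho rho_inv.
      (* At s = m the square vanishes and [upper] is exactly optimality of [mu_tA]; at s = t
         optimality is the hypothesis [lin]. *)
      have := upper m rho rho_inv; rewrite subrr expr0n/= mul0r addr0.
      by rewrite hE -EFinD.
    rewrite -!(mean_scale A_reg z01) lin.
    by apply: ereal_sup_ubound; exists rho.
  exists c, B; split => //; apply: regular_hoelder B_reg => //.
  by rewrite divr_ge0 ?subr_ge0// ltW//; case/andP: z01.
(* The two bounds also make the pressure finite, so that [fine] in [chat] returns its value. *)
have pressureP (s : R) : exists2 q, pressure (fun x : Omega R k => (s * A x)%R) = q%:E &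
    m * s + h <= q <= m * s + h + (s - m) ^+ 2 / 2.
  have le : (pressure (fun x : Omega R k => (s * A x)%R) <= (m * s + h + (s - m) ^+ 2 / 2)%:E)%E.
    apply: ge_ereal_sup => _ [rho rho_inv <-].
    by rewrite (mean_scale A_reg z01); exact: upper.
  have ge : ((m * s + h)%:E <= pressure (fun x : Omega R k => (s * A x)%R))%E.
    apply: ereal_sup_ubound; exists mu_tA => //.
    by rewrite (mean_scale A_reg z01) hE -EFinD mulrC.
  move: le ge; case: (pressure _) => [q|//|//]; rewrite !lee_fin => le ge.
  by exists q => //; rewrite le ge.
have [|d1 d2] := @derive_quadratic_sandwich R (chat A) t m (m * t + h - ln k.+1%:R).
  move=> s; rewrite /chat; have [q -> /= /andP[q1 q2]] := pressureP s.
  by rewrite -tm; apply/andP; split; lra.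
by split.
Qed.
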